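(* Let $l,\lambda$ be non-negative integers, not both zero, and let $$f(s,t_1,\ldots,t_l,u_1,\ldots,u_\lambda)=\sum_{k_1=0}^\infty\cdots\sum_{k_l=0}^\infty\sum_{\nu_1=0}^\infty\cdots\sum_{\nu_\lambda=0}^\infty{}_lF_\lambda(-k_1,\ldots,-k_l;-\nu_1,\ldots,-\nu_\lambda;s)\,t_1^{q^{k_1}}\cdots t_l^{q^{k_l}}u_1^{q^{\nu_1}}\cdots u_\lambda^{q^{\nu_\lambda}},$$ where ${}_lF_\lambda$ are Thakur's hypergeometric polynomials. Then $f\in\mathcal F_{l+\lambda+1}$ and $f$ is quasi-holonomic, i.e. $d(M_f)=l+\lambda+1$.
   Context: Let $q$ be a power of a prime $p$, $K=\mathbb F_q((x))$ the field of formal Laurent series with its absolute value $|x|=q^{-1}$, and $\overline{K}_c$ the completion of an algebraic closure of $K$ with the extended absolute value. Put $[i]=x^{q^i}-x$ ($i\ge1$), $D_i=[i][i-1]^q\cdots[1]^{q^{i-1}}$ and $L_i=[i][i-1]\cdots[1]$ ($i\ge1$), $D_0=L_0=1$. For $a\in\mathbb Z_+$ put $(-a)_m=(-1)^{a-m}L_{a-m}^{-q^m}$ if $m\le a$ and $(-a)_m=0$ if $m>a$. For $a_1,\ldots,a_l,b_1,\ldots,b_\lambda\in\mathbb Z_+$, Thakur's hypergeometric polynomial is $${}_lF_\lambda(-a_1,\ldots,-a_l;-b_1,\ldots,-b_\lambda;z)=\sum_{m}\frac{(-a_1)_m\cdots(-a_l)_m}{(-b_1)_m\cdots(-b_\lambda)_mD_m}z^{q^m},$$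 where the sum is over the terms that make sense and do not vanish, i.e. over $0\le m\le\min(a_1,\ldots,a_l,b_1,\ldots,b_\lambda)$. For $n\ge 1$, $\mathcal F_{n+1}$ is the set of germs at the origin of functions $$f(s,t_1,\ldots,t_n)=\sum_{k_1=0}^\infty\cdots\sum_{k_n=0}^\infty\ \sum_{m=0}^{\min(k_1,\ldots,k_n)}a_{m,k_1,\ldots,k_n}s^{q^m}t_1^{q^{k_1}}\cdots t_n^{q^{k_n}},\qquad a_{m,k_1,\ldots,k_n}\in\overline{K}_c,$$ convergent on some neighbourhood of the origin (above, $n=l+\lambda$ and the last $\lambda$ variables are called $u_1,\ldots,u_\lambda$). The Carlitz ring $\mathfrak A_{n+1}$ is the ring of operators on $\mathcal F_{n+1}$ generated by the multiplications by scalars from $\overline{K}_c$ and the operators $\tau f=f^q$; $d_sf=\bigl(f(xs,t_1,\ldots,t_n)-xf(s,t_1,\ldots,t_n)\bigr)^{1/q}$; and $\Delta_jf=f(s,\ldots,xt_j,\ldots)-xf(s,\ldots,t_j,\ldots)$, $j=1,\ldots,n$. Every element of $\mathfrak A_{n+1}$ is a finite sum $\sum c_{r,\mu,i_1,\ldots,i_n}\tau^rd_s^\mu\Delta_1^{i_1}\cdots\Delta_n^{i_n}$ with coefficients in $\overline{K}_c$. For $0\neq f\in\mathcal F_{n+1}$ let $I_f=\{\varphi\in\mathfrak A_{n+1}:\varphi(f)=0\}$ and $M_f=\mathfrak A_{n+1}/I_f\cong\mathfrak A_{n+1}f$. Let $\mathfrak M_j$ be the $\overline{K}_c$-span of the elements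 $\tau^rd_s^\mu\Delta_1^{i_1}\cdots\Delta_n^{i_n}f$ with $r+\mu+i_1+\cdots+i_n\le j$. There is a polynomial $\chi\in\mathbb Q[t]$ with $\dim_{\overline{K}_c}\mathfrak M_j=\chi(j)$ for all large $j$, and $d(M_f)=\deg\chi$. The function $f$ is called quasi-holonomic if $d(M_f)=n+1$. *)

(* Defs.v *)
From HB Require Import structures.
From mathcomp Require Import all_boot all_order all_algebra.
From mathcomp Require Import classical_sets reals.

Set Implicit Arguments.
Unset Strict Implicit.
Unset Printing Implicit Defensive.

Import Order.TTheory GRing.Theory Num.Theory.
Local Open Scope ring_scope.

Section ValuedField.
Variables (R : realType) (F : finFieldType) (C : fieldType).
Variables (v : C -> R) (iota : {rmorphism F -> C}) (x : C).

Definition converges_to (u : nat -> C) (y : C) : Prop :=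
  forall eps : R, 0 < eps ->
    exists N : nat, forall n : nat, (N <= n)%N -> v (u n - y) < eps.

Definition cauchy_seq (u : nat -> C) : Prop :=
  forall eps : R, 0 < eps ->
    exists N : nat, forall m n : nat,
      (N <= m)%N -> (N <= n)%N -> v (u m - u n) < eps.

(* The copy of F((x)) inside C: if v is a complete non-archimedean absolute
   value with v x = 1 / #|F|, then Laurent series in x over F converge, and
   their sums form a subfield isometric to F((x)). *)
Definition laurent (z : C) : Prop :=
  exists (N : nat) (a : nat -> F),
    converges_to (fun n => \sum_(i < n) iota (a i) * x ^+ i / x ^+ N) z.

Definition laurent_algebraic (z : C) : Prop :=
  exists p : {poly C}, [/\ p != 0, forall i : nat, laurent p`_i & root p z].

End ValuedField.

(* A completion of an algebraic closure of F((x)), with the extended absolute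
   value. The algebraic closure is the set of elements algebraic over F((x));
   it is required to be algebraically closed and dense. *)
Record completedClosure (R : realType) (F : finFieldType) := CompletedClosure {
  cfield :> fieldType;
  absv : cfield -> R;
  scal : {rmorphism F -> cfield};
  xvar : cfield;
  absv_ge0 : forall y, 0 <= absv y;
  absv_eq0 : forall y, (absv y == 0) = (y == 0);
  absvM : forall y z, absv (y * z) = absv y * absv z;
  absvD : forall y z, absv (y + z) <= Num.max (absv y) (absv z);
  absv_xvar : absv xvar = (#|F|%:R)^-1;
  absv_complete : forall u : nat -> cfield,
    cauchy_seq absv u -> exists y, converges_to absv u y;
  alg_closed : forall p : {poly cfield},
    (1 < size p)%N ->
    (forall i : nat, laurent_algebraic absv scal xvar p`_i) ->
    exists2 y, laurent_algebraic absv scal xvar y & root p y;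
  alg_dense : forall (y : cfield) (eps : R), 0 < eps ->
    exists2 z, laurent_algebraic absv scal xvar z & absv (y - z) < eps
}.

Section Carlitz.
Variables (R : realType) (F : finFieldType) (C : completedClosure R F).

(* The cardinality of a finite field is an arbitrary prime power. *)
Local Notation q := (#|F|).
Local Notation x := (xvar C).

Definition brk (i : nat) : C := x ^+ (q ^ i) - x.

Definition carlitzD (i : nat) : C :=
  \prod_(1 <= j < i.+1) brk j ^+ (q ^ (i - j)).

Definition carlitzL (i : nat) : C := \prod_(1 <= j < i.+1) brk j.

(* (-a)_m *)
Definition poch (a m : nat) : C :=
  if (m <= a)%N then (-1) ^+ (a - m) * (carlitzL (a - m) ^+ (q ^ m))^-1 else 0.

(* The upper bound on m only makes the range finite: the filter selects
   exactly m <= min(a_1, ..., a_l, b_1, ..., b_la). *)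
Definition thakur_poly (l la : nat) (a : 'I_l -> nat) (b : 'I_la -> nat)
    (z : C) : C :=
  \sum_(m < (maxn (\max_i a i) (\max_j b j)).+1
        | [forall i, m <= a i]%N && [forall j, m <= b j]%N)
     (\prod_i poch (a i) m) / ((\prod_j poch (b j) m) * carlitzD m)
       * z ^+ (q ^ m).

(* Unconditional summation of a family. *)
Definition has_sum (I : eqType) (u : I -> C) (y : C) : Prop :=
  forall eps : R, 0 < eps ->
    exists s0 : seq I, forall s : seq I,
      uniq s -> {subset s0 <= s} -> absv (\sum_(i <- s) u i - y) < eps.

(* Junk value 0 when the family is not summable. *)
Definition tsum (I : eqType) (u : I -> C) : C :=
  xget 0 [set y | has_sum u y].

Section Functions.
Variable n : nat.

Local Notation fn := (C -> ('I_n -> C) -> C).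

Definition near0 (P : C -> ('I_n -> C) -> Prop) : Prop :=
  exists2 r : R, 0 < r & forall (s : C) (t : 'I_n -> C),
    absv s < r -> (forall i, absv (t i) < r) -> P s t.

(* Germs at the origin are represented by total functions, compared with
   germ_eq. *)
Definition germ_eq (f g : fn) : Prop := near0 (fun s t => f s t = g s t).

(* The set F_{n+1}, for n >= 1; the series runs over (m, k) with
   m <= min(k_1, ..., k_n). *)
Definition in_calF (f : fn) : Prop :=
  exists a : nat -> {ffun 'I_n -> nat} -> C,
    near0 (fun s t =>
      has_sum (fun mk : nat * {ffun 'I_n -> nat} =>
        if [forall i, mk.1 <= mk.2 i]%N then
          a mk.1 mk.2 * s ^+ (q ^ mk.1) * \prod_i t i ^+ (q ^ mk.2 i)
        else 0) (f s t)).

(* The q-th root, unique because q is a power of the characteristic. *)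
Definition qroot (y : C) : C := xget 0 [set z | z ^+ q = y].

Definition tau (f : fn) : fn := fun s t => f s t ^+ q.

Definition ds (f : fn) : fn :=
  fun s t => qroot (f (x * s) t - x * f s t).

Definition Delta (j : 'I_n) (f : fn) : fn :=
  fun s t => f s (fun i => if i == j then x * t i else t i) - x * f s t.

(* tau^r ds^mu Delta_1^(e_1) ... Delta_n^(e_n) f *)
Definition carlitz_monomial (r mu : nat) (e : {ffun 'I_n -> nat}) (f : fn) : fn :=
  iter r tau (iter mu ds
    (foldr (fun j g => iter (e j) (Delta j) g) f (enum 'I_n))).

Definition lin_comb (N : nat) (c : 'I_N -> C) (b : 'I_N -> fn) : fn :=
  fun s t => \sum_i c i * b i s t.

Definition in_span (S : fn -> Prop) (g : fn) : Prop :=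
  exists (N : nat) (c : 'I_N -> C) (b : 'I_N -> fn),
    (forall i, S (b i)) /\ germ_eq g (lin_comb c b).

(* V, a linear space of germs, has dimension N over C. *)
Definition has_dim (V : fn -> Prop) (N : nat) : Prop :=
  exists b : 'I_N -> fn,
    [/\ forall i, V (b i),
        forall c : 'I_N -> C,
          germ_eq (lin_comb c b) (fun _ _ => 0) -> forall i, c i = 0
      & forall g, V g -> exists c : 'I_N -> C, germ_eq g (lin_comb c b)].

(* The j-th term of the filtration of M_f, seen inside the germs through
   the isomorphism of M_f with the orbit of f under the Carlitz ring. *)
Definition Mfilt (f : fn) (j : nat) : fn -> Prop :=
  in_span (fun h => exists (r mu : nat) (e : {ffun 'I_n -> nat}),
    (r + mu + \sum_i e i <= j)%N /\ h = carlitz_monomial r mu e f).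

Definition hilbert_poly (f : fn) (chi : {poly rat}) : Prop :=
  exists J : nat, forall j : nat, (J <= j)%N ->
    exists2 N : nat, has_dim (Mfilt f j) N & N%:R = chi.[j%:R].

(* d(M_f) = d *)
Definition module_dim (f : fn) (d : nat) : Prop :=
  exists2 chi : {poly rat}, hilbert_poly f chi & size chi = d.+1.

Definition quasi_holonomic (f : fn) : Prop :=
  [/\ in_calF f, ~ germ_eq f (fun _ _ => 0) & module_dim f n.+1].

End Functions.

Section HypergeometricFunction.
Variables l la : nat.

(* The variables t_1, ..., t_l, u_1, ..., u_la, and likewise the exponents
   k_1, ..., k_l, nu_1, ..., nu_la, are concatenated into families over
   'I_(l + la). *)
Definition thakur_term (s : C) (t : 'I_(l + la) -> C)
    (k : {ffun 'I_(l + la) -> nat}) : C :=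
  thakur_poly (fun i : 'I_l => k (lshift la i))
              (fun j : 'I_la => k (rshift l j)) s
    * \prod_i t i ^+ (q ^ k i).

Definition thakur_function (s : C) (t : 'I_(l + la) -> C) : C :=
  tsum (thakur_term s t).

End HypergeometricFunction.
End Carlitz.

(* Main.v *)
Require Import Defs.
From HB Require Import structures.
From mathcomp Require Import all_boot all_order all_algebra all_field.
From mathcomp Require Import classical_sets reals boolp.
From mathcomp Require Import zify ring.

Set Implicit Arguments.
Unset Strict Implicit.
Unset Printing Implicit Defensive.

Import Order.TTheory GRing.Theory Num.Theory.
Local Open Scope ring_scope.

(** Write [f] for the generating function and [n = l + la]. Let [S] and [T_j] be
   the dilations of the variables [s] and [t_j] by [x]. They are commuting
   linear operators, and [Delta_j = T_j - x].

   The recursion of the hypergeometric coefficients ([thakur_coefS]) says that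
   [f(x s, t) - x f(s, t) = f(s, t)^q] near the origin ([thakur_function_eq]),
   that is, [tau f = (S - x) f] and [ds f = f]. Since [tau] and [ds] commute
   with dilations up to Frobenius on scalars, the whole Carlitz module of [f]
   consists of the germs [P(S, T_1, ..., T_n) f] with [P] a polynomial, and its
   [j]-th filtration step is spanned by the dilates [S^r T^e f] with
   [r + e_1 + ... + e_n <= j] ([carlitz_monomial_dilates],
   [dilate_carlitz_monomials]). This uses that the complete field is perfect
   ([frob_surj]), so that [ds] maps spans to spans.

   The dilates are linearly independent ([dilates_independent]). The germ
   [P(S, T) f] has the coefficients of [f], all nonzero, multiplied by
   [P(x^(q^m), x^(q^k_1), ..., x^(q^k_n))]; a germ determines its coefficients
   ([series_identity]), and a polynomial vanishing at all these points is zero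
   ([kronecker_separation]). So the [j]-th step has dimension equal to the
   number of monomials of degree at most [j] in [n + 1] variables, the binomial
   coefficient of [j + n + 1] over [n + 1], a polynomial in [j] of degree
   [n + 1].

   Convergence holds because a coefficient of total degree [d] is at most [q^d]
   ([absv_thakur_coef]) and a family that tends to zero is summable
   ([vanishing_has_sum]). *)

(** * The absolute value *)

Section Cardinality.
Variable F : finFieldType.
Local Notation q := (#|F|).

Lemma card_gt1 : (1 < q)%N.
Proof. exact: finNzRing_gt1. Qed.

Lemma card_gt0 : (0 < q)%N.
Proof. exact: ltnW card_gt1. Qed.

Lemma qexp_gt0 i : (0 < q ^ i)%N.
Proof. by rewrite expn_gt0 card_gt0. Qed.

Lemma ltn_qexp i : (i < q ^ i)%N.
Proof. by rewrite ltn_expl // card_gt1. Qed.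

Lemma qexp_inj : injective (fun i => q ^ i)%N.
Proof. exact: expnI card_gt1. Qed.
End Cardinality.

Section AbsoluteValue.
Variables (R : realType) (F : finFieldType) (C : completedClosure R F).
Implicit Types (y z : C) (e : R).
Local Notation q := (#|F|).
Local Notation x := (xvar C).

Lemma absv0 : absv (0 : C) = 0.
Proof. by apply/eqP; rewrite absv_eq0. Qed.

Lemma absv_gt0 y : (0 < absv y) = (y != 0).
Proof. by rewrite lt_def absv_eq0 absv_ge0 andbT. Qed.

Lemma absv1 : absv (1 : C) = 1.
Proof.
have h : absv (1 : C) != 0 by rewrite absv_eq0 oner_neq0.
by apply: (mulfI h); rewrite -absvM !mulr1.
Qed.

Lemma absvX y k : absv (y ^+ k) = absv y ^+ k.
Proof. by elim: k => [|k IH]; rewrite ?expr0 ?absv1 // !exprS absvM IH. Qed.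

Lemma absvN y : absv (- y) = absv y.
Proof.
suff h : absv (-1 : C) = 1 by rewrite -mulN1r absvM h mul1r.
apply/eqP; rewrite -sqrp_eq1 ?absv_ge0 // -absvX sqrrN expr1n absv1 //.
Qed.

Lemma absvV y : absv y^-1 = (absv y)^-1.
Proof.
have [->|h] := eqVneq y 0; first by rewrite invr0 absv0 invr0.
have h' : absv y != 0 by rewrite absv_eq0.
by apply: (mulfI h'); rewrite -absvM !divff // absv1.
Qed.

Lemma absvBC y z : absv (y - z) = absv (z - y).
Proof. by rewrite -absvN opprB. Qed.

Lemma absv_prod (I : Type) (r : seq I) (P : pred I) (u : I -> C) :
  absv (\prod_(i <- r | P i) u i) = \prod_(i <- r | P i) absv (u i).
Proof. exact: (big_morph _ (@absvM _ _ C) absv1). Qed.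

Lemma absvD_lt e y z : absv y < e -> absv z < e -> absv (y + z) < e.
Proof.
by move=> h1 h2; apply: le_lt_trans (absvD _ _) _; rewrite gt_max h1.
Qed.

Lemma absvB_lt e y z : absv y < e -> absv z < e -> absv (y - z) < e.
Proof. by move=> h1 h2; apply: absvD_lt; rewrite ?absvN. Qed.

Lemma absv_sum_lt (I : eqType) (r : seq I) (u : I -> C) e :
  0 < e -> (forall i, i \in r -> absv (u i) < e) ->
  absv (\sum_(i <- r) u i) < e.
Proof.
move=> e0 h; rewrite big_seq.
apply: (big_ind (fun y : C => absv y < e)) => //; first by rewrite absv0.
by move=> y z; apply: absvD_lt.
Qed.

(** The isosceles property of a non-archimedean absolute value. *)
Lemma absvD_dom y z : absv z < absv y -> absv (y + z) = absv y.
Proof.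
move=> h; apply/eqP; rewrite eq_le; apply/andP; split.
  by apply: le_trans (absvD _ _) _; rewrite ge_max lexx ltW.
have := absvD (y + z) (- z); rewrite addrK absvN le_max.
by case/orP => //; rewrite leNgt h.
Qed.

Lemma absvP_eq0 y : (forall e, 0 < e -> absv y < e) -> y = 0.
Proof.
move=> h; apply/eqP; apply: contraT => /[dup] y0; rewrite -absv_gt0 => /h.
by rewrite ltxx.
Qed.

Lemma natq_gt1 : 1 < q%:R :> R.
Proof. by rewrite ltr1n card_gt1. Qed.

Lemma natq_gt0 : 0 < q%:R :> R.
Proof. by rewrite ltr0n card_gt0. Qed.

Lemma absv_xvar_gt0 : 0 < absv x.
Proof. by rewrite absv_xvar invr_gt0 natq_gt0. Qed.

Lemma absv_xvar_lt1 : absv x < 1.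
Proof. by rewrite absv_xvar invf_lt1 ?natq_gt0 // natq_gt1. Qed.

Lemma xvar_neq0 : x != 0.
Proof. by rewrite -absv_gt0 absv_xvar_gt0. Qed.

(** Distinct powers of [x] have distinct absolute values. *)
Lemma xvarX_inj : injective (fun k => x ^+ k).
Proof.
move=> i j /(congr1 (@absv _ _ _)); rewrite !absvX => h; apply/eqP.
have le_x := ler_iXn2l absv_xvar_gt0 absv_xvar_lt1.
by rewrite eqn_leq -!le_x h lexx.
Qed.

Lemma xvarX_small e : 0 < e ->
  exists N, forall k, (N <= k)%N -> absv x ^+ k < e.
Proof.
move=> e0; exists (Num.bound e^-1) => k hk.
rewrite absv_xvar exprVn -natrX invf_plt ?posrE ?ltr0n ?qexp_gt0 //.
apply: lt_le_trans (archi_boundP _) _; first by rewrite invr_ge0 ltW.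
by rewrite ler_nat (leq_trans hk) // ltnW // ltn_expl // card_gt1.
Qed.

Lemma absv_brk i : absv (brk C i.+1) = absv x.
Proof.
rewrite /brk addrC absvD_dom ?absvN // absvX -[X in _ < X]expr1.
rewrite ltr_iXn2l ?absv_xvar_gt0 ?absv_xvar_lt1 //.
by rewrite -{1}(expn0 q) ltn_exp2l // card_gt1.
Qed.

Lemma brk_neq0 i : (0 < i)%N -> brk C i != 0.
Proof. by case: i => // i _; rewrite -absv_gt0 absv_brk absv_xvar_gt0. Qed.

Lemma brk0 : brk C 0 = 0.
Proof. by rewrite /brk expn0 expr1 subrr. Qed.

End AbsoluteValue.

(** * The Frobenius map of the complete field *)

Section Frobenius.
Variables (R : realType) (F : finFieldType) (C : completedClosure R F).
Implicit Types y z : C.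
Local Notation q := (#|F|).
Local Notation x := (xvar C).

Lemma pchar_card : [pchar C].-nat q.
Proof.
have [p pr_p chp] := finPcharP F.
have -> : q = (p ^ logn p q)%N := card_pprimeChar chp.
rewrite pnatX; apply/orP; left; rewrite pnatE //.
by rewrite (rmorph_pchar (scal C)).
Qed.

Lemma frobD y z i : (y + z) ^+ (q ^ i) = y ^+ (q ^ i) + z ^+ (q ^ i).
Proof. by rewrite exprDn_pchar // pnatX pchar_card. Qed.

Lemma frobN y i : (- y) ^+ (q ^ i) = - y ^+ (q ^ i).
Proof. by rewrite exprNn_pchar // pnatX pchar_card. Qed.

Lemma frobB y z i : (y - z) ^+ (q ^ i) = y ^+ (q ^ i) - z ^+ (q ^ i).
Proof. by rewrite frobD frobN. Qed.

Lemma frob_sum (I : Type) (r : seq I) (P : pred I) (u : I -> C) i :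
  (\sum_(k <- r | P k) u k) ^+ (q ^ i) = \sum_(k <- r | P k) u k ^+ (q ^ i).
Proof.
apply: (big_morph (fun y : C => y ^+ (q ^ i))).
  by move=> y z; apply: frobD.
by rewrite expr0n -[(_ == _)]negbK -lt0n qexp_gt0.
Qed.

Lemma frob_inj : injective (fun y : C => y ^+ q).
Proof.
move=> y z /= h; apply/eqP; rewrite -subr_eq0; suff: (y - z) ^+ q == 0.
  by rewrite expf_eq0 => /andP[].
by rewrite -[q]expn1 frobB expn1 h subrr.
Qed.

Lemma laurent_const (a : F) : laurent (@absv _ _ C) (scal C) x (scal C a).
Proof.
exists 0, (fun i => if i == 0 then a else 0) => e e0; exists 1 => -[//|k] _.
rewrite big_ord_recl big1 /= ?addr0 ?expr0 ?mulr1 ?divr1 ?subrr ?absv0 //.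
by move=> i _; rewrite rmorph0 mul0r mul0r.
Qed.

Lemma laurent_algebraic_const (a : F) :
  laurent_algebraic (@absv _ _ C) (scal C) x (scal C a).
Proof.
exists ('X - (scal C a)%:P); split; first by rewrite polyXsubC_eq0.
  move=> i; rewrite coefB coefX coefC.
  case: i => [|[|i]] /=; rewrite ?subr0 ?sub0r.
  - by rewrite -rmorphN; apply: laurent_const.
  - by rewrite -(rmorph1 (scal C)); apply: laurent_const.
  - by have := laurent_const 0; rewrite rmorph0.
by rewrite root_XsubC.
Qed.

(** Approximate [y] by algebraic elements; these have algebraic [q]-th roots,
   which form a Cauchy sequence because
   [absv (z - z') ^+ q = absv (z ^+ q - z' ^+ q)]. Its limit is the root. *)
Lemma frob_surj y : exists z, z ^+ q = y.
Proof.
have alg_root w : laurent_algebraic (@absv _ _ C) (scal C) x w ->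
    exists z, z ^+ q = - w.
  move=> hw; have [||z _] := @alg_closed _ _ C ('X^q + w%:P).
  - by rewrite size_XnaddC ?card_gt0 // ltnS card_gt0.
  - move=> i; rewrite coefD coefXn coefC.
    have [->|i0] := eqVneq i 0.
      by rewrite eq_sym -[_ == _]negbK -lt0n card_gt0 add0r.
    rewrite addr0; case: (i == q); rewrite ?mulr1n ?mulr0n.
      by rewrite -(rmorph1 (scal C)); apply: laurent_algebraic_const.
    by have := laurent_algebraic_const 0; rewrite rmorph0.
  by rewrite rootE !hornerE => /eqP h; exists z; apply/eqP; rewrite -addr_eq0 h.
pose e (k : nat) : R := absv x ^+ k.
have e0 k : 0 < e k by rewrite exprn_gt0 // absv_xvar_gt0.
(* A root of ['X^q + w] is a [q]-th root of [- w], so [w] approximates [- y]. *)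
have appr k : exists z, absv (z ^+ q - y) < e k ^+ q.
  have [w hw lew] := @alg_dense _ _ C (- y) (e k ^+ q) (exprn_gt0 _ (e0 k)).
  have [z hz] := alg_root w hw; exists z.
  by rewrite hz addrC.
have [z hz] := choice appr.
have near_y (eps : R) : 0 < eps ->
    exists N, forall k, (N <= k)%N -> absv (z k ^+ q - y) < eps ^+ q.
  move=> /(xvarX_small C)[N hN]; exists N => k hk.
  apply: lt_trans (hz k) _; rewrite ltrXn2r ?(ltW (e0 k)) ?hN //.
  by rewrite -lt0n card_gt0.
have frobv (u w : C) : absv (u - w) ^+ q = absv (u ^+ q - w ^+ q).
  by rewrite -absvX -[q]expn1 frobB.
have lt_root (u w : C) (eps : R) : 0 < eps ->
    (absv (u ^+ q - w ^+ q) < eps ^+ q) = (absv (u - w) < eps).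
  by move=> eps0; rewrite -frobv ltr_pXn2r ?nnegrE ?absv_ge0 ?card_gt0 ?ltW.
have [|z' hz'] := @absv_complete _ _ C z.
  move=> eps eps0; have [N hN] := near_y _ eps0; exists N => i j hi hj.
  rewrite -lt_root //; have := absvB_lt (hN i hi) (hN j hj).
  by rewrite opprB addrA subrK.
exists z'; apply/eqP; rewrite -subr_eq0; apply/eqP.
apply: absvP_eq0 => eps eps0.
have [K hK] := xvarX_small C eps0.
apply: (@lt_trans _ _ (e K)); last exact: hK.
apply: (@lt_le_trans _ _ (e K ^+ q)); last first.
  apply: ler_iXnr (card_gt0 F) (ltW (e0 K)) _.
  by rewrite exprn_ile1 ?absv_ge0 // ltW ?absv_xvar_lt1.
have [N1 h1] := near_y _ (e0 K); have [N2 h2] := hz' _ (e0 K).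
have {}h2 := h2 _ (leq_maxr N1 N2); have {}h1 := h1 _ (leq_maxl N1 N2).
rewrite -(subrKA (z (maxn N1 N2) ^+ q)) absvD_lt // absvBC lt_root //.
Qed.
End Frobenius.

(** * Unconditional summation *)

Section Summation.
Variables (R : realType) (F : finFieldType) (C : completedClosure R F).
Local Notation q := (#|F|).

Lemma has_sum_unique (I : eqType) (u : I -> C) y z :
  has_sum u y -> has_sum u z -> y = z.
Proof.
move=> hy hz; apply/eqP; rewrite -subr_eq0; apply/eqP/absvP_eq0 => e e0.
have [sy {}hy] := hy e e0; have [sz {}hz] := hz e e0.
pose s := undup (sy ++ sz).
have us : uniq s by rewrite undup_uniq.
have {}hy : absv (\sum_(i <- s) u i - y) < e.
  by apply: hy => // i hi; rewrite mem_undup mem_cat hi.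
have {}hz : absv (\sum_(i <- s) u i - z) < e.
  by apply: hz => // i hi; rewrite mem_undup mem_cat hi orbT.
by have := absvB_lt hz hy; rewrite opprB addrC addrA subrK.
Qed.

Lemma tsumE (I : eqType) (u : I -> C) y : has_sum u y -> tsum u = y.
Proof.
move=> hy; apply: (has_sum_unique _ hy).
by apply: (@xgetPex _ _ [set z | has_sum u z]%classic); exists y.
Qed.

Lemma eq_has_sum (I : eqType) (u w : I -> C) y :
  u =1 w -> has_sum u y -> has_sum w y.
Proof. by move=> /funext->. Qed.

Lemma has_sum_const0 (I : eqType) : has_sum (fun _ : I => 0 : C) 0.
Proof.
by move=> e e0; exists [::] => s _ _; rewrite big1 // subr0 absv0.
Qed.

Lemma has_sumD (I : eqType) (u w : I -> C) y z :
  has_sum u y -> has_sum w z -> has_sum (fun i => u i + w i) (y + z).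
Proof.
move=> hy hz e e0.
have [sy {}hy] := hy e e0; have [sz {}hz] := hz e e0.
exists (sy ++ sz) => s us hs; rewrite big_split /= opprD addrACA absvD_lt //.
  by apply: hy => // i hi; rewrite hs // mem_cat hi.
by apply: hz => // i hi; rewrite hs // mem_cat hi orbT.
Qed.

Lemma has_sumZ (I : eqType) (u : I -> C) c y :
  has_sum u y -> has_sum (fun i => c * u i) (c * y).
Proof.
have [->|c0] := eqVneq c 0 => hy.
  rewrite mul0r; apply: eq_has_sum (has_sum_const0 I) => i.
  by rewrite mul0r.
move=> e e0; have ac : 0 < absv c by rewrite absv_gt0.
have [|s0 {}hy] := hy (e / absv c); first by rewrite divr_gt0.
exists s0 => s us hs; rewrite -mulr_sumr -mulrBr absvM mulrC -ltr_pdivlMr //.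
exact: hy.
Qed.

Lemma has_sum_lincomb (I : eqType) (J : finType) (c : J -> C) (u : J -> I -> C)
    (y : J -> C) : (forall j, has_sum (u j) (y j)) ->
  has_sum (fun i => \sum_j c j * u j i) (\sum_j c j * y j).
Proof.
move=> hu; suff h (r : seq J) :
    has_sum (fun i => \sum_(j <- r) c j * u j i) (\sum_(j <- r) c j * y j).
  exact: h.
elim: r => [|j r IH].
  rewrite big_nil; apply: eq_has_sum (has_sum_const0 I) => i.
  by rewrite big_nil.
rewrite big_cons; apply: eq_has_sum (has_sumD (has_sumZ (c j) (hu j)) IH) => i.
by rewrite big_cons.
Qed.

Lemma has_sum_frob (I : eqType) (u : I -> C) y :
  has_sum u y -> has_sum (fun i => u i ^+ q) (y ^+ q).
Proof.
move=> hy e e0; have [|s0 {}hy] := hy (Num.min e 1).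
  by rewrite lt_min e0 ltr01.
exists s0 => s us hs; have := hy s us hs; rewrite lt_min => /andP[lte lt1].
rewrite -[q]expn1 -frob_sum -frobB expn1 absvX; apply: le_lt_trans lte.
by rewrite ler_iXnr ?card_gt0 ?absv_ge0 // ltW.
Qed.

(** A sum may be evaluated by grouping its terms into finite blocks [L j],
   the fibres of a map [p] restricted to a set that carries all nonzero
   terms. With blocks of size at most one this is a reindexing. *)
Lemma has_sum_fibres (I J : eqType) (u : I -> C) y (p : I -> J)
    (L : J -> seq I) :
  (forall j, uniq (L j)) -> (forall j i, i \in L j -> p i = j) ->
  (forall i, u i != 0 -> i \in L (p i)) ->
  has_sum u y -> has_sum (fun j => \sum_(i <- L j) u i) y.
Proof.
move=> uL pL suppL hu e /hu[s0 {}hu]; exists (map p s0) => s us hs.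
pose t := flatten (map L s).
have mem_t i : i \in t = (p i \in s) && (i \in L (p i)).
  apply/flatten_mapP/andP => [[j js ij]|[ps iL]]; last by exists (p i).
  by rewrite (pL _ _ ij).
have ut : uniq t.
  rewrite /t; elim: s us {hs t mem_t} => //= j s IH /andP[js us].
  rewrite cat_uniq uL IH // andbT; apply/hasPn => i /flatten_mapP[k ks ik].
  by apply: contra js => ij; rewrite -(pL _ _ ij) (pL _ _ ik).
have -> : \sum_(j <- s) \sum_(i <- L j) u i = \sum_(i <- t) u i.
  by rewrite /t big_flatten big_map.
(* The elements of [s0] missed by the blocks are zero terms: adding them
   changes nothing. *)
pose t0 := [seq i <- undup s0 | i \notin t].
have t0E : \sum_(i <- t0) u i = 0.
  rewrite big_seq big1 // => i; rewrite mem_filter mem_undup => /andP[it is0].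
  apply: contraNeq it => /suppL iL; rewrite mem_t iL andbT.
  by apply: hs; apply: map_f.
have -> : \sum_(i <- t) u i = \sum_(i <- t ++ t0) u i.
  by rewrite big_cat /= t0E addr0.
apply: hu.
  rewrite cat_uniq ut filter_uniq ?undup_uniq // andbT.
  by apply/hasPn => i; rewrite mem_filter => /andP[].
move=> i is0; rewrite mem_cat mem_filter mem_undup is0 andbT.
by case: (i \in t).
Qed.

(** A finite sum of terms below [e] is below [e], so the sums over finite sets
   that exhaust the large terms form a Cauchy sequence. *)
Lemma vanishing_has_sum (I : eqType) (u : I -> C) :
  (forall e : R, 0 < e ->
     exists s : seq I, forall i, i \notin s -> absv (u i) < e) ->
  exists y, has_sum u y.
Proof.
move=> hu; pose e (k : nat) : R := absv (xvar C) ^+ k.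
have e0 k : 0 < e k by rewrite exprn_gt0 // absv_xvar_gt0.
have [s0 hs0] := choice (fun k => hu (e k) (e0 k)).
pose S k := undup (flatten [seq s0 i | i <- iota 0 k.+1]).
have small k (s s' : seq I) : uniq s -> uniq s' -> {subset s0 k <= s} ->
    {subset s <= s'} -> absv (\sum_(i <- s') u i - \sum_(i <- s) u i) < e k.
  move=> us us' hs hss'.
  have : perm_eq s' (s ++ [seq i <- s' | i \notin s]).
    apply: uniq_perm => //.
      rewrite cat_uniq us filter_uniq // andbT.
      by apply/hasPn => i; rewrite mem_filter => /andP[].
    move=> i; rewrite mem_cat mem_filter.
    by case: (boolP (i \in s)) => //= /hss'.
  move=> ss'; rewrite (perm_big _ ss') big_cat /= addrAC subrr add0r.
  apply: absv_sum_lt => // i; rewrite mem_filter => /andP[iS _].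
  by apply: hs0; apply: contra iS => /hs.
have subS k : {subset s0 k <= S k}.
  move=> i hi; rewrite mem_undup; apply/flatten_mapP; exists k => //.
  by rewrite mem_iota /= ltnSn.
have subSS k m : (k <= m)%N -> {subset S k <= S m}.
  move=> km i; rewrite /S !mem_undup => /flatten_mapP[j].
  rewrite mem_iota => hj.
  by move=> ij; apply/flatten_mapP; exists j; rewrite // mem_iota; lia.
have [|y hy] := @absv_complete _ _ C (fun k => \sum_(i <- S k) u i).
  move=> eps /(xvarX_small C)[N hN]; exists N => i j hi hj.
  have h k : (N <= k)%N ->
      absv (\sum_(i <- S k) u i - \sum_(i <- S N) u i) < eps.
    move=> Nk; apply: lt_trans (hN N (leqnn _)).
    by apply: small (subS N) (subSS _ _ Nk); rewrite undup_uniq.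
  by have := absvB_lt (h i hi) (h j hj); rewrite opprB addrA subrK.
exists y => eps eps0; have [N hN] := xvarX_small C eps0.
have [M hM] := hy eps eps0; exists (S (maxn N M)) => s us hs.
rewrite -(subrKA (\sum_(i <- S (maxn N M)) u i)) absvD_lt //.
  apply: lt_trans (hN (maxn N M) (leq_maxl _ _)).
  by apply: small hs; rewrite ?undup_uniq.
exact: hM (leq_maxr _ _).
Qed.

(** A term strictly larger than all others gives its absolute value to every
   finite sum containing it, hence to the total sum. *)
Lemma has_sum0_not_dominated (I : eqType) (u : I -> C) i0 :
  has_sum u 0 -> u i0 != 0 ->
  ~ (forall i, i != i0 -> absv (u i) < absv (u i0)).
Proof.
move=> hu u0 dom; have a0 : 0 < absv (u i0) by rewrite absv_gt0.
have [s0 {}hu] := hu _ a0.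
pose s := undup (i0 :: s0).
have us : uniq s := undup_uniq _.
have hs : {subset s0 <= s} by move=> i hi; rewrite mem_undup inE hi orbT.
have := hu s us hs; rewrite subr0 (bigD1_seq i0) ?mem_undup ?mem_head //=.
rewrite absvD_dom ?ltxx //.
rewrite -big_filter; apply: absv_sum_lt => // i.
by rewrite mem_filter => /andP[/dom].
Qed.
End Summation.

(** * The hypergeometric coefficients *)

Section Coefficients.
Variables (R : realType) (F : finFieldType) (C : completedClosure R F).
Local Notation q := (#|F|).
Local Notation x := (xvar C).
Local Notation Q := (q%:R : R).

Lemma carlitzD_S m : carlitzD C m.+1 = brk C m.+1 * carlitzD C m ^+ q.
Proof.
rewrite /carlitzD big_nat_recr //= subnn expn0 expr1 mulrC; congr (_ * _).
rewrite -prodrXl big_nat_cond [RHS]big_nat_cond; apply: eq_bigr => j.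
by move=> /andP[/andP[_ jm] _]; rewrite subSn // expnSr exprM.
Qed.

Lemma carlitzD_neq0 m : carlitzD C m != 0.
Proof.
elim: m => [|m IH]; first by rewrite /carlitzD big_geq // oner_neq0.
by rewrite carlitzD_S mulf_neq0 ?expf_neq0 ?brk_neq0.
Qed.

Lemma absv_carlitzD m : (absv (carlitzD C m))^-1 <= Q ^+ (q ^ m).
Proof.
pose d m := (\sum_(i < m) q ^ i)%N.
have dlt k : (d k < q ^ k)%N.
  rewrite /d; elim: k => [|k IH]; first by rewrite big_ord0.
  rewrite big_ord_recr /= expnS; apply: (@leq_trans (2 * q ^ k)).
    by rewrite mul2n -addnn ltn_add2r.
  by rewrite leq_mul2r card_gt1 orbT.
suff -> : absv (carlitzD C m) = absv x ^+ d m.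
  by rewrite absv_xvar -exprVn invrK ler_weXn2l ?(ltW (natq_gt1 _ _)) // ltnW.
elim: m => [|m IH]; first by rewrite /carlitzD big_geq // /d big_ord0 absv1.
rewrite carlitzD_S absvM absvX IH absv_brk -exprM -exprS; congr (_ ^+ _).
rewrite /d big_ord_recl expn0 /= add1n; congr _.+1.
rewrite big_distrl /=; apply: eq_bigr => i _.
by rewrite expnSr.
Qed.

Lemma absv_carlitzL i : absv (carlitzL C i) = absv x ^+ i.
Proof.
rewrite /carlitzL; elim: i => [|i IH]; first by rewrite big_geq // absv1.
by rewrite big_nat_recr //= absvM IH absv_brk exprSr.
Qed.

Lemma absv_poch a m : (m <= a)%N ->
  absv (poch C a m) = Q ^+ ((a - m) * q ^ m).
Proof.
move=> ma; rewrite /poch ma absvM absvX absvN absv1 expr1n mul1r absvV absvX.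
by rewrite absv_carlitzL absv_xvar !exprVn -exprM invrK.
Qed.

Lemma poch_neq0 a m : (m <= a)%N -> poch C a m != 0.
Proof.
move=> /absv_poch h; rewrite -absv_gt0 h exprn_gt0 //.
exact: natq_gt0.
Qed.

Lemma absv_poch_le a m : (m <= a)%N -> absv (poch C a m) <= Q ^+ (q ^ a).
Proof.
move=> ma; rewrite absv_poch // ler_weXn2l ?(ltW (natq_gt1 _ _)) //.
rewrite -{2}(subnK ma) expnD leq_mul2r ltnW ?orbT //.
exact: ltn_qexp.
Qed.

Lemma absv_pochV_le a m : (m <= a)%N -> (absv (poch C a m))^-1 <= Q ^+ (q ^ a).
Proof.
move=> ma; apply: (@le_trans _ _ 1); last first.
  by rewrite exprn_ege1 // ltW ?natq_gt1.
rewrite absv_poch // invf_le1 ?exprn_gt0 ?natq_gt0 //.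
by rewrite exprn_ege1 // ltW ?natq_gt1.
Qed.

Lemma pochS a m : (m <= a)%N -> poch C a.+1 m.+1 = poch C a m ^+ q.
Proof.
move=> ma; rewrite /poch ltnS ma subSS exprMn -exprM mulnC exprM; congr (_ * _).
  by rewrite -[q]expn1 frobN expn1 expr1n.
by rewrite exprVn -exprM expnSr.
Qed.

Variables l la : nat.
Local Notation n := (l + la)%N.
Implicit Types (k : {ffun 'I_n -> nat}) (m : nat).

Definition thakur_coef m k : C :=
  (\prod_i poch C (k (lshift la i)) m)
    / ((\prod_j poch C (k (rshift l j)) m) * carlitzD C m).

Definition succ_idx k : {ffun 'I_n -> nat} := [ffun i => (k i).+1].
Definition pred_idx k : {ffun 'I_n -> nat} := [ffun i => (k i).-1].

Lemma thakur_coef_neq0 m k :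
  (forall i, m <= k i)%N -> thakur_coef m k != 0.
Proof.
move=> mk; rewrite mulf_neq0 ?invr_eq0 ?mulf_neq0 ?carlitzD_neq0 //.
  by apply/prodf_neq0 => i _; apply: poch_neq0.
by apply/prodf_neq0 => i _; apply: poch_neq0.
Qed.

(** Shifting all indices by one raises each Pochhammer symbol to the power [q],
   and [D_(m+1) = [m+1] D_m^q]. This recursion is the source of the functional
   equation of the generating function. *)
Lemma thakur_coefS m k : (forall i, m <= k i)%N ->
  brk C m.+1 * thakur_coef m.+1 (succ_idx k) = thakur_coef m k ^+ q.
Proof.
move=> mk; rewrite /thakur_coef carlitzD_S expr_div_n exprMn -!prodrXl.
have e (I : finType) (h : I -> 'I_n) :
    \prod_i poch C (succ_idx k (h i)) m.+1 = \prod_i poch C (k (h i)) m ^+ q.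
  by apply: eq_bigr => i _; rewrite ffunE pochS.
rewrite !e mulrCA; congr (_ * _).
by rewrite mulrCA invfM mulrA divff ?mul1r ?brk_neq0.
Qed.

Definition total_deg (mk : nat * {ffun 'I_n -> nat}) : nat :=
  (q ^ mk.1 + \sum_i q ^ mk.2 i)%N.

(** The exponent [(a - m) q^m] of [absv (poch C a m)] is at most [q^a] because
   [a - m <= q^(a - m)]; inverse symbols and inverse [D_m] are as tame. *)
Lemma absv_thakur_coef m k : (forall i, m <= k i)%N ->
  absv (thakur_coef m k) <= Q ^+ total_deg (m, k).
Proof.
move=> mk; rewrite /thakur_coef absvM absvV absvM invfM 2!absv_prod.
rewrite /total_deg /= big_split_ord /= [(q ^ m + _)%N]addnC exprD exprD.
rewrite -!prodrXr mulrA -prodfV.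
apply: ler_pM; rewrite ?invr_ge0 ?absv_ge0 ?absv_carlitzD //.
  by rewrite mulr_ge0 ?prodr_ge0 // => i _; rewrite ?invr_ge0 absv_ge0.
apply: ler_pM.
- by apply: prodr_ge0 => i _; apply: absv_ge0.
- by apply: prodr_ge0 => i _; rewrite invr_ge0 absv_ge0.
- by apply: ler_prod => i _; rewrite absv_ge0 absv_poch_le.
- by apply: ler_prod => i _; rewrite invr_ge0 absv_ge0 absv_pochV_le.
Qed.
End Coefficients.

(** * The generating function *)

Section GeneratingFunction.
Variables (R : realType) (F : finFieldType) (C : completedClosure R F).
Local Notation q := (#|F|).
Local Notation x := (xvar C).
Variables l la : nat.
Local Notation n := (l + la)%N.
Local Notation idx := (nat * {ffun 'I_n -> nat})%type.
Implicit Types (s : C) (t : 'I_n -> C) (mk : idx).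

Definition series_term s t mk : C :=
  if [forall i, mk.1 <= mk.2 i]%N then
    thakur_coef C mk.1 mk.2 * s ^+ (q ^ mk.1) * \prod_i t i ^+ (q ^ mk.2 i)
  else 0.

(** On this polydisc a monomial of degree [d] is at most [q^(-2d)], which beats
   the bound [q^d] for its coefficient. *)
Definition in_disc s t : Prop :=
  absv s < absv x ^+ 2 /\ forall i, absv (t i) < absv x ^+ 2.

Lemma near0_disc (P : C -> ('I_n -> C) -> Prop) :
  (forall s t, in_disc s t -> P s t) -> near0 P.
Proof.
move=> hP; exists (absv x ^+ 2); first by rewrite exprn_gt0 // absv_xvar_gt0.
by move=> s t hs ht; apply: hP.
Qed.

Lemma absv_series_term s t mk : in_disc s t ->
  absv (series_term s t mk) <= absv x ^+ total_deg F mk.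
Proof.
case: mk => m k [hs ht]; have a0 := absv_xvar_gt0 C.
rewrite /series_term /=; case: ifP => [/forallP mk|_]; last first.
  by rewrite absv0 exprn_ge0 // ltW.
have -> : absv x ^+ total_deg F (m, k) =
    q%:R ^+ total_deg F (m, k) * ((absv x ^+ 2) ^+ (q ^ m) *
      \prod_i (absv x ^+ 2) ^+ (q ^ k i)).
  rewrite prodrXr -exprD -exprMn expr2 mulrA -[X in _ = (X * _ * _) ^+ _]invrK.
  by rewrite -(absv_xvar C) mulVf ?mul1r // gt_eqF.
rewrite -mulrA absvM; apply: ler_pM; rewrite ?absv_ge0 //.
  exact: absv_thakur_coef.
rewrite absvM absv_prod absvX; apply: ler_pM; rewrite ?exprn_ge0 ?absv_ge0 //.
- by apply: prodr_ge0 => i _; apply: absv_ge0.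
- by apply: lerXn2r; rewrite ?nnegrE ?absv_ge0 ?exprn_ge0 ?ltW.
- apply: ler_prod => i _; rewrite absv_ge0 absvX /=.
  by apply: lerXn2r; rewrite ?nnegrE ?absv_ge0 ?exprn_ge0 ?ltW.
Qed.

Lemma total_deg_cofinite N :
  exists S : seq idx, forall mk, mk \notin S -> (N <= total_deg F mk)%N.
Proof.
pose nat_ffun (g : {ffun 'I_n -> 'I_N.+1}) : {ffun 'I_n -> nat} :=
  [ffun i => nat_of_ord (g i)].
exists [seq (m, nat_ffun g) |
  m <- iota 0 N, g <- enum {: {ffun 'I_n -> 'I_N.+1}}].
case=> m k.
apply: contraR; rewrite -ltnNge /total_deg /= => dN.
have mN : (m < N)%N.
  apply: leq_ltn_trans dN.
  by rewrite (leq_trans (ltnW (ltn_qexp F m))) // leq_addr.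
have kN i : (k i < N)%N.
  apply: leq_ltn_trans dN; rewrite (leq_trans (ltnW (ltn_qexp F (k i)))) //.
  by rewrite (leq_trans _ (leq_addl _ _)) // (bigD1 i) //= leq_addr.
apply/allpairsP; exists (m, [ffun i => inord (k i)]); split => /=.
- by rewrite mem_iota.
- by rewrite mem_enum.
- by congr pair; apply/ffunP => i; rewrite !ffunE inordK // ltnW // ltnS.
Qed.

Lemma series_summable s t : in_disc s t ->
  exists y, has_sum (series_term s t) y.
Proof.
move=> hst; apply: vanishing_has_sum => e /(xvarX_small C)[N hN].
have [S hS] := total_deg_cofinite N; exists S => mk /hS /hN.
exact: le_lt_trans (absv_series_term _ hst).
Qed.

Lemma forall_split m (k : 'I_n -> nat) :
  [forall i, m <= k i]%N =
  [forall i, m <= k (lshift la i)]%N && [forall j, m <= k (rshift l j)]%N.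
Proof.
apply/forallP/andP => [h|[/forallP h1 /forallP h2] i].
  by split; apply/forallP => i.
by have [j ->|j ->] := split_ordP i.
Qed.

Hypothesis n_gt0 : (0 < n)%N.

Lemma thakur_term_has_sum s t y :
  has_sum (series_term s t) y -> has_sum (thakur_term s t) y.
Proof.
pose B (k : {ffun 'I_n -> nat}) :=
  (maxn (\max_i k (lshift la i)) (\max_j k (rshift l j))).+1.
pose L (k : {ffun 'I_n -> nat}) : seq idx :=
  [seq (m, k) | m <- index_iota 0 (B k) & [forall i, m <= k i]%N].
move=> /(@has_sum_fibres _ _ _ _ _ _ _ snd L) h.
have {}h : has_sum (fun k => \sum_(i <- L k) series_term s t i) y.
  apply: h => [k|k i /mapP[m _ ->]//|[m k] h].
    by rewrite map_inj_uniq ?filter_uniq ?iota_uniq // => a b [].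
  apply/mapP; exists m => //; rewrite mem_filter; move: h; rewrite /series_term.
  case: ifP => [mk _|_]; last by rewrite eqxx.
  rewrite andTb mem_index_iota /B ltnS leq_max.
  have /forallP/(_ (Ordinal n_gt0)) := mk.
  have [j ->|j ->] := split_ordP (Ordinal n_gt0) => mj; apply/orP; [left|right].
    exact: leq_trans mj (leq_bigmax (F := fun i => k (lshift la i)) j).
  exact: leq_trans mj (leq_bigmax (F := fun j => k (rshift l j)) j).
apply: eq_has_sum h => k; rewrite /thakur_term /thakur_poly big_map big_filter.
rewrite big_mkord mulr_suml.
apply: eq_big => [m|m mk]; first exact: forall_split.
by rewrite /series_term /= mk /thakur_coef.
Qed.

Lemma thakur_functionP s t : in_disc s t ->
  has_sum (series_term s t) (thakur_function s t).
Proof.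
move=> /series_summable[y hy]; suff <- : y = thakur_function s t by [].
by rewrite /thakur_function (tsumE (thakur_term_has_sum hy)).
Qed.

Lemma in_disc_dilate s t c d : absv c <= 1 -> (forall i, absv (d i) <= 1) ->
  in_disc s t -> in_disc (c * s) (fun i => d i * t i).
Proof.
move=> c1 d1 [hs ht]; split=> [|i]; rewrite absvM.
  by apply: le_lt_trans hs; rewrite ler_piMl ?absv_ge0.
by apply: le_lt_trans (ht i); rewrite ler_piMl ?absv_ge0.
Qed.

Lemma series_term_dilate s t c d mk :
  series_term (c * s) (fun i => d i * t i) mk =
  c ^+ (q ^ mk.1) * \prod_i d i ^+ (q ^ mk.2 i) * series_term s t mk.
Proof.
rewrite /series_term; case: ifP => _; last by rewrite mulr0.
rewrite exprMn (eq_bigr (fun i => d i ^+ (q ^ mk.2 i) * t i ^+ (q ^ mk.2 i))).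
  by rewrite big_split /=; ring.
by move=> i _; rewrite exprMn.
Qed.

(** The left side multiplies the term of index [(m, k)] by [brk C m]. This kills
   the terms with [m = 0]; by [thakur_coefS] the term of index
   [(m + 1, k + 1)] becomes the [q]-th power of the term of index [(m, k)]. In
   other words [ds] fixes the germ. *)
Lemma thakur_function_eq s t : in_disc s t ->
  thakur_function (x * s) t - x * thakur_function s t
    = thakur_function s t ^+ q.
Proof.
move=> hst; have hf := thakur_functionP hst.
have x1 : absv x <= 1 := ltW (absv_xvar_lt1 C).
have hxst : in_disc (x * s) t.
  case: hst => hs ht; split => //; rewrite absvM.
  by apply: le_lt_trans hs; rewrite ler_piMl ?absv_ge0.
pose u mk := brk C mk.1 * series_term s t mk.
have hu : has_sum u (thakur_function (x * s) t - x * thakur_function s t).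
  rewrite -mulNr.
  have hxf := has_sumD (thakur_functionP hxst) (has_sumZ (- x) hf).
  apply: eq_has_sum hxf => mk.
  have -> : series_term (x * s) t mk = x ^+ (q ^ mk.1) * series_term s t mk.
    rewrite {1}(_ : t = fun i => 1 * t i) ?series_term_dilate.
      by rewrite big1 ?mulr1 // => i _; rewrite expr1n.
    by apply/funext => i; rewrite mul1r.
  by rewrite /u /brk; ring.
apply: has_sum_unique (has_sum_frob hf).
pose p (mk : idx) : idx := (mk.1.-1, pred_idx mk.2).
pose L (mk : idx) : seq idx := [:: (mk.1.+1, succ_idx mk.2)].
have {}hu := has_sum_fibres (p := p) (L := L) _ _ _ hu.
apply: eq_has_sum (hu _ _ _) => {hu}.
- move=> [m k]; rewrite /L big_seq1 /u /series_term /=.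
  have -> : [forall i, m < succ_idx k i]%N = [forall i, m <= k i]%N.
    by apply: eq_forallb => i; rewrite ffunE ltnS.
  case: ifP => [/forallP mk|_]; last first.
    by rewrite mulr0 expr0n gtn_eqF // card_gt0.
  rewrite 2!mulrA thakur_coefS //.
  move: (thakur_coef _ _ _) => c; rewrite 2!exprMn -!exprM -expnSr -prodrXl.
  by congr (_ * _); apply: eq_bigr => i _; rewrite ffunE -exprM -expnSr.
- by [].
- move=> [m k] [m' k']; rewrite inE => /eqP[-> ->]; congr pair => /=.
  by apply/ffunP => i; rewrite !ffunE.
- move=> [m k]; rewrite /u /series_term /=; case: m => [|m].
    by rewrite brk0 mul0r eqxx.
  case: ifP => [/forallP mk _|_]; last by rewrite mulr0 eqxx.
  rewrite inE; apply/eqP; congr pair; apply/ffunP => i; rewrite !ffunE.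
  by rewrite prednK // (leq_trans _ (mk i)).
Qed.
End GeneratingFunction.

(** * Germs, spans and operators *)

Section Operators.
Variables (R : realType) (F : finFieldType) (C : completedClosure R F).
Local Notation q := (#|F|).
Local Notation x := (xvar C).
Variable n : nat.
Local Notation tau := (@tau R F C n).
Local Notation fn := (C -> ('I_n -> C) -> C).
Implicit Types (f g h : fn) (s : C) (t : 'I_n -> C) (e : {ffun 'I_n -> nat}).

Lemma near0_all (P : C -> ('I_n -> C) -> Prop) :
  (forall s t, P s t) -> near0 P.
Proof. by move=> hP; exists 1. Qed.

Lemma near0S (P P' : C -> ('I_n -> C) -> Prop) :
  (forall s t, P s t -> P' s t) -> near0 P -> near0 P'.
Proof. by move=> hP [r r0 h]; exists r => // s t hs ht; apply/hP/h. Qed.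

Lemma near0_and (P P' : C -> ('I_n -> C) -> Prop) :
  near0 P -> near0 P' -> near0 (fun s t => P s t /\ P' s t).
Proof.
move=> [r r0 h] [r' r0' h']; exists (Num.min r r'); first by rewrite lt_min r0.
move=> s t; rewrite lt_min => /andP[hs hs'] ht.
by split; [apply: h|apply: h'] => // i; have := ht i; rewrite lt_min => /andP[].
Qed.

Lemma near0_dilate (P : C -> ('I_n -> C) -> Prop) r e :
  near0 P -> near0 (fun s t => P (x ^+ r * s) (fun j => x ^+ e j * t j)).
Proof.
have x1 (k : nat) y : absv (x ^+ k * y) <= absv y.
  rewrite absvM ler_piMl ?absv_ge0 // absvX exprn_ile1 ?absv_ge0 //.
  by rewrite ltW ?absv_xvar_lt1.
move=> [d d0 h]; exists d => // s t hs ht.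
by apply: h => [|i]; apply: le_lt_trans (x1 _ _) _.
Qed.

Lemma germ_eq_sym g h : germ_eq g h -> germ_eq h g.
Proof. exact: near0S. Qed.

Lemma germ_eq_trans g h f : germ_eq g h -> germ_eq h f -> germ_eq g f.
Proof.
by move=> gh hf; apply: near0S (near0_and gh hf) => s t [-> ->].
Qed.

Section Span.
Variable S : fn -> Prop.

Lemma in_span_germ g h : germ_eq g h -> in_span S h -> in_span S g.
Proof.
move=> gh [N [c [b [Sb hb]]]]; exists N, c, b; split => //.
exact: germ_eq_trans hb.
Qed.

Lemma in_span_gen g : S g -> in_span S g.
Proof.
move=> Sg; exists 1, (fun=> 1), (fun=> g); split=> //.
by apply: near0_all => s t; rewrite /lin_comb big_ord1 mul1r.
Qed.

Lemma in_span0 : in_span S (fun _ _ => 0).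
Proof.
exists 0, (fun=> 1), (fun _ _ _ => 0); split; first by case.
by apply: near0_all => s t; rewrite /lin_comb big_ord0.
Qed.

Lemma in_spanZ c g : in_span S g -> in_span S (fun s t => c * g s t).
Proof.
move=> [N [a [b [Sb hb]]]]; exists N, (fun i => c * a i), b; split=> //.
apply: near0S hb => s t ->; rewrite /lin_comb mulr_sumr.
by apply: eq_bigr => i _; rewrite mulrA.
Qed.

Lemma in_spanD g h : in_span S g -> in_span S h ->
  in_span S (fun s t => g s t + h s t).
Proof.
move=> [N [a [b [Sb hb]]]] [N' [a' [b' [Sb' hb']]]].
pose pick (T : Type) (u : 'I_N -> T) (u' : 'I_N' -> T) (i : 'I_(N + N')) :=
  match split i with inl j => u j | inr j => u' j end.
have pickl T (u : 'I_N -> T) u' i : pick T u u' (lshift N' i) = u i.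
  by rewrite /pick (unsplitK (inl i)).
have pickr T (u : 'I_N -> T) u' i : pick T u u' (rshift N i) = u' i.
  by rewrite /pick (unsplitK (inr i)).
exists (N + N')%N, (pick _ a a'), (pick _ b b'); split.
  by move=> i; have [j ->|j ->] := split_ordP i; rewrite ?pickl ?pickr.
apply: near0S (near0_and hb hb') => s t [-> ->].
rewrite /lin_comb big_split_ord /=.
by congr (_ + _); apply: eq_bigr => i _; rewrite ?pickl ?pickr.
Qed.

Lemma in_span_lin_comb N (c : 'I_N -> C) (b : 'I_N -> fn) :
  (forall i, in_span S (b i)) -> in_span S (lin_comb c b).
Proof.
move=> hb; suff h (r : seq 'I_N) :
    in_span S (fun s t => \sum_(i <- r) c i * b i s t).
  exact: h.
elim: r => [|i r IH].
  by apply: in_span_germ in_span0; apply: near0_all => s t; rewrite big_nil.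
apply: in_span_germ (in_spanD (in_spanZ (c i) (hb i)) IH).
by apply: near0_all => s t; rewrite big_cons.
Qed.
End Span.

Lemma in_span_sub (S S' : fn -> Prop) g :
  (forall h, S h -> in_span S' h) -> in_span S g -> in_span S' g.
Proof.
move=> SS' [N [c [b [Sb hb]]]]; apply: in_span_germ hb _.
by apply: in_span_lin_comb => i; apply: SS'.
Qed.

(** The map [phi] is the identity for [Delta] and for dilations, Frobenius for
   [tau] and the inverse of Frobenius for [ds]. *)
Lemma in_span_op (Op : fn -> fn) (phi : C -> C) (S S' : fn -> Prop) g :
  (forall h h', germ_eq h h' -> germ_eq (Op h) (Op h')) ->
  (forall N (c : 'I_N -> C) b,
     Op (lin_comb c b) = lin_comb (fun i => phi (c i)) (fun i => Op (b i))) ->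
  (forall h, S h -> in_span S' (Op h)) ->
  in_span S g -> in_span S' (Op g).
Proof.
move=> local lin SS' [N [c [b [Sb hb]]]].
apply: in_span_germ (local _ _ hb) _; rewrite lin.
by apply: in_span_lin_comb => i; apply: SS'.
Qed.

Definition dilate (r : nat) e (g : fn) : fn :=
  fun s t => g (x ^+ r * s) (fun j => x ^+ e j * t j).

Definition unit_exp (j : 'I_n) : {ffun 'I_n -> nat} :=
  [ffun i => (i == j) : nat].

Definition add_exp e e' : {ffun 'I_n -> nat} := [ffun i => (e i + e' i)%N].

Definition zero_exp : {ffun 'I_n -> nat} := [ffun=> 0%N].

Lemma dilate_comp r e r' e' g :
  dilate r e (dilate r' e' g) = dilate (r + r') (add_exp e e') g.
Proof.
apply/funext => s; apply/funext => t; rewrite /dilate; congr (g _ _).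
  by rewrite exprD mulrA [x ^+ r' * _]mulrC.
by apply/funext => j; rewrite ffunE exprD mulrA [x ^+ e' j * _]mulrC.
Qed.

Lemma dilate0 g : dilate 0 zero_exp g = g.
Proof.
apply/funext => s; apply/funext => t; rewrite /dilate mul1r; congr (g _ _).
by apply/funext => j; rewrite ffunE mul1r.
Qed.

Lemma Delta_dilate j g :
  Delta j g = fun s t => dilate 0 (unit_exp j) g s t - x * g s t.
Proof.
apply/funext => s; apply/funext => t; rewrite /Delta /dilate mul1r.
congr (g _ _ - _); apply/funext => i; rewrite ffunE.
by case: (i == j); rewrite ?expr1 ?expr0 ?mul1r.
Qed.

Lemma dilate_Delta j g :
  dilate 0 (unit_exp j) g = fun s t => Delta j g s t + x * g s t.
Proof.
by rewrite Delta_dilate; apply/funext => s; apply/funext => t; rewrite subrK.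
Qed.

Lemma ds_dilate g :
  ds g = fun s t => qroot (dilate 1 zero_exp g s t - x * g s t).
Proof.
apply/funext => s; apply/funext => t; rewrite /ds /dilate expr1.
by congr (qroot (g _ _ - _)); apply/funext => i; rewrite ffunE mul1r.
Qed.

Lemma qrootK (y : C) : qroot y ^+ q = y.
Proof. exact: (@xgetPex _ 0 [set z | z ^+ q = y]%classic (frob_surj y)). Qed.

Lemma exprqK (y : C) : qroot (y ^+ q) = y.
Proof. by apply: frob_inj; rewrite qrootK. Qed.

Lemma frobq_sum (I : Type) (r : seq I) (u : I -> C) :
  (\sum_(i <- r) u i) ^+ q = \sum_(i <- r) u i ^+ q.
Proof. by rewrite -[q]expn1 frob_sum. Qed.

Lemma dilate_local r e g h :
  germ_eq g h -> germ_eq (dilate r e g) (dilate r e h).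
Proof. exact: near0_dilate. Qed.

Lemma Delta_local j g h : germ_eq g h -> germ_eq (Delta j g) (Delta j h).
Proof.
move=> gh; rewrite !Delta_dilate.
by apply: near0S (near0_and gh (dilate_local 0 (unit_exp j) gh)) => s t [-> ->].
Qed.

Lemma tau_local g h : germ_eq g h -> germ_eq (tau g) (tau h).
Proof. by apply: near0S => s t; rewrite /Defs.tau => ->. Qed.

Lemma iter_tau_local r g h :
  germ_eq g h -> germ_eq (iter r tau g) (iter r tau h).
Proof. by move=> gh; elim: r => //= r; apply: tau_local. Qed.

Lemma ds_local g h : germ_eq g h -> germ_eq (ds g) (ds h).
Proof.
move=> gh; rewrite !ds_dilate.
by apply: near0S (near0_and gh (dilate_local 1 zero_exp gh)) => s t [-> ->].
Qed.

Lemma Delta_lin j N (c : 'I_N -> C) (b : 'I_N -> fn) :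
  Delta j (lin_comb c b) = lin_comb c (fun i => Delta j (b i)).
Proof.
apply/funext => s; apply/funext => t; rewrite /Delta /lin_comb mulr_sumr -sumrB.
by apply: eq_bigr => i _; rewrite mulrBr mulrCA.
Qed.

Lemma tau_lin N (c : 'I_N -> C) (b : 'I_N -> fn) :
  tau (lin_comb c b) = lin_comb (fun i => c i ^+ q) (fun i => tau (b i)).
Proof.
apply/funext => s; apply/funext => t; rewrite /Defs.tau /lin_comb frobq_sum.
by apply: eq_bigr => i _; rewrite exprMn.
Qed.

Lemma ds_lin N (c : 'I_N -> C) (b : 'I_N -> fn) :
  ds (lin_comb c b) = lin_comb (fun i => qroot (c i)) (fun i => ds (b i)).
Proof.
apply/funext => s; apply/funext => t; apply: frob_inj; rewrite qrootK.
rewrite /lin_comb frobq_sum mulr_sumr -sumrB.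
by apply: eq_bigr => i _; rewrite exprMn !qrootK mulrBr mulrCA.
Qed.

Lemma dilate_iter_tau r e k g :
  dilate r e (iter k tau g) = iter k tau (dilate r e g).
Proof. by elim: k => //= k <-. Qed.

Lemma iter_tau_affine k c g h :
  iter k tau (fun s t => g s t + c * h s t)
  = fun s t => iter k tau g s t + c ^+ (q ^ k) * iter k tau h s t.
Proof.
elim: k => [|k IH]; first by rewrite /= expn0 expr1.
rewrite /= IH; apply/funext => s; apply/funext => t.
rewrite /Defs.tau -[X in (_ + _) ^+ X]expn1 frobD expn1 exprMn -exprM.
by rewrite -expnSr.
Qed.

Definition Deltas e (L : seq 'I_n) (g : fn) : fn :=
  foldr (fun j g => iter (e j) (Delta j) g) g L.

Lemma Delta_comm i j g : Delta i (Delta j g) = Delta j (Delta i g).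
Proof.
have dd a b : dilate 0 a (dilate 0 b g) = dilate 0 b (dilate 0 a g).
  rewrite !dilate_comp; congr (dilate _ _ g); apply/ffunP => k.
  by rewrite !ffunE addnC.
rewrite !Delta_dilate; apply/funext => s; apply/funext => t.
have := congr1 (fun h : fn => h s t) (dd (unit_exp i) (unit_exp j)).
by rewrite /dilate => ->; ring.
Qed.

Lemma Delta_Deltas e j L g : uniq L -> j \in L ->
  Delta j (Deltas e L g) = Deltas (add_exp (unit_exp j) e) L g.
Proof.
elim: L => //= i L IH /andP[iL uL]; rewrite inE ffunE ffunE.
have [ij _|ne /= jL] := eqVneq j i; first subst i.
  rewrite -iterS add1n; congr (iter _ _ _).
  rewrite /Deltas; elim: L iL {IH uL} => //= k L IH; rewrite inE negb_or.
  by move=> /andP[ne /IH->]; rewrite !ffunE [k == _]eq_sym (negPf ne).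
rewrite add0n -IH //.
by elim: (e i) => //= k <-; rewrite Delta_comm.
Qed.

Lemma Deltas0 L g : Deltas zero_exp L g = g.
Proof. by elim: L => //= j L ->; rewrite ffunE. Qed.
End Operators.

(** * Linear independence of the dilates *)

Section Digits.
Local Open Scope nat_scope.

Lemma digit_inj B a b a' b' : a < B -> a' < B ->
  a + B * b = a' + B * b' -> a = a' /\ b = b'.
Proof.
move=> aB aB' h; have B0 : 0 < B by case: B aB {h aB'}.
have e : a = a'.
  have /= := congr1 (modn^~ B) h.
  by rewrite ![B * _]mulnC ![_ + _ * B]addnC !modnMDl !modn_small.
by split=> //; move: h; rewrite e => /addnI/eqP; rewrite eqn_pmul2l // => /eqP.
Qed.

Lemma digits_inj B n (e e' : 'I_n -> nat) :
  (forall i, e i < B) -> (forall i, e' i < B) ->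
  \sum_i e i * B ^ i = \sum_i e' i * B ^ i -> e =1 e'.
Proof.
elim: n e e' => [|n IH] e e' he he'; first by move=> _ [].
have E (d : 'I_n.+1 -> nat) : \sum_i d i * B ^ i =
    d ord0 + B * \sum_i d (lift ord0 i) * B ^ i.
  rewrite big_ord_recl expn0 muln1 big_distrr /=; congr (_ + _).
  by apply: eq_bigr => i _; rewrite expnS mulnCA.
rewrite !E => /digit_inj[||h0 hS i] //.
have [j ->|->] := unliftP ord0 i; last exact: h0.
exact: (IH (fun i => e (lift ord0 i)) (fun i => e' (lift ord0 i))).
Qed.
End Digits.

Section Independence.
Variables (R : realType) (F : finFieldType) (C : completedClosure R F).
Local Notation q := (#|F|).
Local Notation x := (xvar C).
Variables l la : nat.
Local Notation n := (l + la)%N.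
Local Notation idx := (nat * {ffun 'I_n -> nat})%type.
Implicit Types (s : C) (t : 'I_n -> C) (mk : idx).

Lemma poly_roots_qpow (P : {poly C}) :
  (forall a, root P (x ^+ (q ^ a))) -> P = 0.
Proof.
move=> hP; apply/eqP; apply: contraT => P0.
have := max_poly_roots (rs := [seq x ^+ (q ^ a) | a <- iota 0 (size P)]) P0 _ _.
rewrite size_map size_iota ltnn; apply.
  by apply/allP => _ /mapP[a _ ->].
rewrite map_inj_uniq ?iota_uniq // => a b /xvarX_inj.
exact: qexp_inj.
Qed.

(** The sums are the values of a polynomial in [n + 1] variables at the points
   [(x^(q^m), x^(q^k_1), ..., x^(q^k_n))] with [m <= min k]. On the points with
   [k_j = m + b (j + 1)] the Kronecker substitution of base [q^b] turns it into
   a polynomial in the single variable [x^(q^m)], which has infinitely many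
   roots; monomials stay separate because [q^b] exceeds all exponents. *)
Lemma kronecker_separation (I : finType) (r : I -> nat)
    (e : I -> {ffun 'I_n -> nat}) (c : I -> C) :
  injective (fun i => (r i, e i)) ->
  (forall m (k : {ffun 'I_n -> nat}), (forall j, m <= k j)%N ->
     \sum_i c i * (x ^+ (r i * q ^ m) * \prod_j x ^+ (e i j * q ^ k j)) = 0) ->
  forall i, c i = 0.
Proof.
move=> inj_re hc.
pose b := (\sum_i (r i + \sum_j e i j)).+1; pose B := (q ^ b)%N.
have ltB a i : (a <= r i + \sum_j e i j)%N -> (a < B)%N.
  move=> h; apply: leq_ltn_trans (ltn_qexp F b); apply: leq_trans h _.
  by apply: leq_trans (leqnSn _); rewrite (bigD1 i) //= leq_addr.
have rB i : (r i < B)%N by apply: (ltB _ i); rewrite leq_addr.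
have eB i j : (e i j < B)%N.
  by apply: (ltB _ i); rewrite (bigD1 j) //= addnCA leq_addr.
pose D i := (r i + B * \sum_j e i j * B ^ j)%N.
have inj_D : injective D.
  move=> i i' /digit_inj[//|//|hr hd]; apply: inj_re.
  by rewrite hr; congr pair; apply/ffunP; apply: digits_inj hd.
pose P := \sum_i c i *: 'X^(D i).
have P0 : P = 0.
  apply: poly_roots_qpow => a; apply/eqP.
  rewrite -(hc a [ffun j : 'I_n => (a + b * j.+1)%N]); last first.
    by move=> j; rewrite ffunE leq_addr.
  rewrite horner_sum; apply: eq_bigr => i _; rewrite hornerZ hornerXn.
  congr (_ * _); rewrite prodrXr -exprD -exprM; congr (_ ^+ _).
  rewrite /D mulnDr mulnC mulnCA !big_distrr /=; congr (_ + _)%N.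
  apply: eq_bigr => j _; rewrite ffunE expnD expnM expnS -/B.
  ring.
move=> i; have := congr1 (fun P : {poly C} => P`_(D i)) P0.
rewrite coef_sum coef0 (bigD1 i) //= big1 ?addr0 ?coefZ ?coefXn ?eqxx ?mulr1 //.
by move=> i' ne; rewrite coefZ coefXn (inj_eq inj_D) eq_sym (negPf ne) mulr0.
Qed.

(** Uniqueness of coefficients. If some coefficient is nonzero, give the
   variables the weights [W + 1] and [W + B^(j + 1)]. With [W] large, terms of
   least weight have least total degree; then all their exponents are digits in
   base [B], so only one term has least weight. It dominates all others at
   [s = z^(W + 1)], [t_j = z^(W + B^(j + 1))] for small [z]. *)
Lemma series_identity (p : idx -> C) (M : R) :
  (forall mk, absv (p mk) <= M) ->
  near0 (fun s t => has_sum (fun mk => p mk * series_term s t mk) 0) ->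
  forall m (k : {ffun 'I_n -> nat}), (forall j, m <= k j)%N -> p (m, k) = 0.
Proof.
move=> pM [rad rad0 hsum] m1 k1 mk1; apply: contrapT => p1.
pose supp mk := (forall j, mk.1 <= mk.2 j)%N /\ p mk <> 0.
have minimum (w : idx -> nat) :
    exists mk, supp mk /\ forall mk', supp mk' -> (w mk <= w mk')%N.
  have ex : exists d, `[< exists2 mk, supp mk & w mk = d >].
    by exists (w (m1, k1)); apply/asboolP; exists (m1, k1).
  have [d /asboolP[mk smk <-] dmin] := ex_minnP ex.
  by exists mk; split => // mk' smk'; apply: dmin; apply/asboolP; exists mk'.
have [mkN [sN minN]] := minimum (@total_deg F l la).
pose N := total_deg F mkN; pose B := N.+1.
pose v mk := (q ^ mk.1 + B * \sum_(j < n) q ^ mk.2 j * B ^ j)%N.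
pose W := (v mkN).+1; pose E mk := (W * total_deg F mk + v mk)%N.
have [i0 [s0 min0]] := minimum E.
have deg_le mk : (E mk <= E i0)%N -> (total_deg F mk <= N)%N.
  move=> h; have : (E mk < W * N.+1)%N.
    apply: leq_ltn_trans (leq_trans h (min0 _ sN)) _.
    by rewrite /E -/N mulnS addnC ltn_add2r.
  rewrite /E => h'; have := leq_ltn_trans (leq_addr _ _) h'.
  by rewrite ltn_pmul2l // ltnS.
have dig mk : (E mk <= E i0)%N ->
    (q ^ mk.1 < B)%N /\ forall j, (q ^ mk.2 j < B)%N.
  move=> /deg_le h; rewrite /B !ltnS; split => [|j].
    by apply: leq_trans h; rewrite leq_addr.
  rewrite ltnS; apply: leq_trans h.
  by rewrite /total_deg (bigD1 j) //= addnCA leq_addr.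
have E_lt mk : supp mk -> mk != i0 -> (E i0 < E mk)%N.
  move=> smk ne; rewrite ltn_neqAle min0 // andbT.
  apply: contra ne => /eqP hE.
  have dE : total_deg F mk = total_deg F i0.
    have dN mk' : supp mk' -> (E mk' <= E i0)%N -> total_deg F mk' = N.
      by move=> smk' /deg_le h; apply/eqP; rewrite eqn_leq h minN.
    by rewrite !dN // hE.
  have vE : v i0 = v mk by move: hE; rewrite /E dE => /addnI.
  have [a1 b1] := dig i0 (leqnn _).
  have [|a2 b2] := dig mk; first by rewrite hE.
  have [/qexp_inj em ek] := digit_inj a1 a2 vE.
  have {}ek := digits_inj b1 b2 ek.
  rewrite [mk]surjective_pairing [i0]surjective_pairing -em; apply/eqP.
  congr pair; apply/ffunP => j; apply: (@qexp_inj F); exact/esym/ek.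
pose a mk := p mk * thakur_coef C mk.1 mk.2.
have a0 : 0 < absv (a i0).
  by rewrite absv_gt0 mulf_neq0 ?thakur_coef_neq0 //; case: s0 => // _ /eqP.
have M0 : 0 <= M by apply: le_trans (pM i0); rewrite absv_ge0.
pose al := absv x; have al0 : 0 < al := absv_xvar_gt0 C.
have al1 : al < 1 := absv_xvar_lt1 C.
have [K1 hK1] : exists K, forall k, (K <= k)%N ->
    al ^+ k < absv (a i0) / (M + 1).
  by apply: xvarX_small; rewrite divr_gt0 // ltr_wpDl.
have [K2 hK2] : exists K, forall k, (K <= k)%N -> al ^+ k < rad.
  exact: xvarX_small.
pose T := (maxn K1 K2 + (E i0).+1)%N.
pose z : C := x ^+ T.
pose s := z ^+ W.+1; pose t (j : 'I_n) := z ^+ (W + B ^ j.+1).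
have small_z k : (0 < k)%N -> absv (z ^+ k) < rad.
  move=> k0; rewrite /z -exprM absvX hK2 // (@leq_trans T) //.
    by rewrite /T (leq_trans (leq_maxr K1 K2)) // leq_addr.
  by rewrite leq_pmulr.
have {}hsum : has_sum (fun mk => p mk * series_term s t mk) 0.
  apply: hsum => [|j]; apply: small_z => //.
have termE mk : (forall j, mk.1 <= mk.2 j)%N ->
    p mk * series_term s t mk = a mk * z ^+ E mk.
  move=> /forallP h; rewrite /series_term h /s /a.
  move: (thakur_coef _ _ _) => cf; rewrite -!mulrA; congr (_ * (_ * _)).
  have -> : \prod_j t j ^+ (q ^ mk.2 j) =
      \prod_(j < n) z ^+ ((W + B ^ j.+1) * q ^ mk.2 j).
    by apply: eq_bigr => j _; rewrite -(exprM z).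
  rewrite prodrXr -(exprM z) -(exprD z); congr (_ ^+ _).
  rewrite /E /v /total_deg; move: (W) => w.
  have -> : (\sum_(j < n) (w + B ^ j.+1) * q ^ mk.2 j =
      w * \sum_j q ^ mk.2 j + B * \sum_(j < n) q ^ mk.2 j * B ^ j)%N.
    rewrite !big_distrr /= -big_split /=; apply: eq_bigr => j _.
    by rewrite expnS; ring.
  ring.
have z0 : z != 0 by rewrite expf_neq0 ?xvar_neq0.
apply: (has_sum0_not_dominated (i0 := i0) hsum).
  rewrite termE; last by case: s0.
  by apply: mulf_neq0; rewrite ?expf_neq0 // -absv_gt0.
move=> mk ne; rewrite [in ltRHS]termE; last by case: s0.
have pos : 0 < absv (a i0 * z ^+ E i0).
  by rewrite absv_gt0 mulf_neq0 ?expf_neq0 // -absv_gt0.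
have [smk|nsmk] := pselect (supp mk); last first.
  suff -> : p mk * series_term s t mk = 0 by rewrite absv0.
  rewrite /series_term; case: ifP => [/forallP h|_]; last by rewrite mulr0.
  have [->|/eqP pn] := eqVneq (p mk) 0; first by rewrite mul0r.
  by case: nsmk; split.
rewrite termE; last by case: smk.
rewrite (absvM (a mk)) (absvM (a i0)).
have le_a : absv (a mk) <= M * al^-1 ^+ E mk.
  rewrite /a absvM; apply: ler_pM; rewrite ?absv_ge0 ?pM //.
  case: mk smk {ne} => m k smk.
  apply: le_trans (absv_thakur_coef C (proj1 smk)) _.
  rewrite /al absv_xvar invrK.
  rewrite ler_weXn2l ?(ltW (natq_gt1 _ _)) //.
  by apply: leq_trans (leq_addr _ _); rewrite leq_pmull.
have lt_E := E_lt _ smk ne.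
pose T' := (maxn K1 K2 + E i0)%N; have TE : T = T'.+1 by rewrite /T addnS.
(* One of the [T] factors compensates the growth of the coefficients, and
   the surplus of weight makes the remaining [T'] factors small. *)
have step : absv (a mk) * absv (z ^+ E mk) <= M * al ^+ (T' * E mk).
  apply: le_trans (_ : M * al^-1 ^+ E mk * absv (z ^+ E mk) <= _).
    by rewrite ler_wpM2r ?absv_ge0.
  rewrite -mulrA ler_wpM2l // /z TE -exprM absvX mulSn exprD mulrA -exprMn.
  by rewrite mulVf ?gt_eqF // expr1n mul1r.
apply: le_lt_trans step _.
apply: (@le_lt_trans _ _ (M * al ^+ (T' * (E i0).+1))).
  by rewrite ler_wpM2l // ler_iXn2l // leq_mul2l lt_E orbT.
have -> : (T' * (E i0).+1 = maxn K1 K2 + T * E i0)%N by rewrite /T /T'; nia.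
rewrite exprD mulrA /z -exprM absvX ltr_pM2r ?exprn_gt0 //.
apply: (@le_lt_trans _ _ ((M + 1) * al ^+ maxn K1 K2)).
  by rewrite ler_wpM2r ?exprn_ge0 ?(ltW al0) // lerDl ler01.
by rewrite mulrC -ltr_pdivlMr ?ltr_wpDl // hK1 // leq_maxl.
Qed.

Hypothesis n_gt0 : (0 < n)%N.


(** A dilate has the coefficients of the generating function multiplied by
   monomials in the [x^(q^m)] and [x^(q^k_j)]; uniqueness of coefficients turns
   a relation between dilates into a polynomial that vanishes at all these
   points. *)
Lemma dilates_independent (I : finType) (r : I -> nat)
    (e : I -> {ffun 'I_n -> nat}) (c : I -> C) :
  injective (fun i => (r i, e i)) ->
  near0 (fun s t =>
    \sum_i c i * dilate (r i) (e i) (@thakur_function R F C l la) s t = 0) ->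
  forall i, c i = 0.
Proof.
move=> inj_re [rad rad0 hc].
pose p (mk : idx) :=
  \sum_i c i * (x ^+ (r i * q ^ mk.1) * \prod_j x ^+ (e i j * q ^ mk.2 j)).
apply: (kronecker_separation inj_re) => m k mk.
apply: (@series_identity p (\sum_i absv (c i))) mk => [mk|].
  rewrite /p; elim/big_rec2: _ => [|i M y _ IH]; first by rewrite absv0.
  apply: le_trans (absvD _ _) _; rewrite ge_max; apply/andP; split.
    rewrite prodrXr -exprD absvM absvX ler_wpDr ?(le_trans _ IH) ?absv_ge0 //.
    by rewrite ler_piMr ?absv_ge0 // exprn_ile1 ?absv_ge0 // ltW ?absv_xvar_lt1.
  by rewrite (le_trans IH) // lerDr absv_ge0.
exists (Num.min rad (absv x ^+ 2)).
  by rewrite lt_min rad0 exprn_gt0 ?absv_xvar_gt0.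
move=> s t; rewrite lt_min => /andP[hs hs'] ht.
have hst : in_disc s t.
  by split=> // j; have := ht j; rewrite lt_min => /andP[].
rewrite -(hc s t hs); last by move=> j; have := ht j; rewrite lt_min => /andP[].
have x1 k' : absv (x ^+ k') <= 1.
  by rewrite absvX exprn_ile1 ?absv_ge0 // ltW ?absv_xvar_lt1.
have hd i := thakur_functionP n_gt0
  (in_disc_dilate (x1 (r i)) (fun j => x1 (e i j)) hst).
apply: eq_has_sum (has_sum_lincomb c hd) => mk'.
rewrite /p mulr_suml; apply: eq_bigr => i _; rewrite series_term_dilate.
rewrite -exprM -!mulrA; congr (_ * (_ * (_ * _))).
by apply: eq_bigr => j _; rewrite exprM.
Qed.
End Independence.

(** * The filtration of the Carlitz module *)

Section CarlitzModule.
Variables (R : realType) (F : finFieldType) (C : completedClosure R F).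
Local Notation q := (#|F|).
Local Notation x := (xvar C).
Variables l la : nat.
Local Notation n := (l + la)%N.
Local Notation fn := (C -> ('I_n -> C) -> C).
Local Notation f := (@thakur_function R F C l la).
Local Notation tau := (@tau R F C n).
Hypothesis n_gt0 : (0 < n)%N.
Implicit Types (r d : nat) (e : {ffun 'I_n -> nat}) (g : fn).

Definition dilates d : fn -> Prop := fun h =>
  exists r e, (r + \sum_i e i <= d)%N /\ h = dilate r e f.

Definition carlitz_monomials d : fn -> Prop := fun h =>
  exists r mu e, (r + mu + \sum_i e i <= d)%N /\ h = carlitz_monomial r mu e f.

Lemma sum_unit_exp (j : 'I_n) : (\sum_i unit_exp j i)%N = 1.
Proof.
by rewrite (bigD1 j) //= ffunE eqxx big1 // => i ne; rewrite ffunE (negPf ne).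
Qed.

Lemma sum_add_exp e e' :
  (\sum_i add_exp e e' i = \sum_i e i + \sum_i e' i)%N.
Proof. by rewrite -big_split; apply: eq_bigr => i _; rewrite ffunE. Qed.

Lemma sum_zero_exp : (\sum_i zero_exp n i)%N = 0%N.
Proof. by rewrite big1 // => i _; rewrite ffunE. Qed.

(** Dilations commute with the [q]-th power, so the functional equation of [f]
   passes to its dilates. It expresses [tau] of a dilate by two dilates, and
   shows that [ds] fixes every dilate. *)
Lemma dilate_eq r e :
  germ_eq (fun s t => dilate r.+1 e f s t - x * dilate r e f s t)
          (tau (dilate r e f)).
Proof.
have h : germ_eq (fun s t => f (x * s) t - x * f s t) (tau f).
  by apply: near0_disc => s t /(thakur_function_eq n_gt0).
apply: germ_eq_trans (dilate_local r e h); apply: near0_all => s t.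
by rewrite /dilate exprS mulrA.
Qed.

Lemma span_dilates_le d d' g : (d <= d')%N ->
  in_span (dilates d) g -> in_span (dilates d') g.
Proof.
move=> dd'; apply: in_span_sub => h [r [e [de ->]]]; apply: in_span_gen.
by exists r, e; split=> //; apply: leq_trans dd'.
Qed.

Lemma span_dilates_Delta d j g :
  in_span (dilates d) g -> in_span (dilates d.+1) (Delta j g).
Proof.
apply: (in_span_op (phi := id)).
- exact: Delta_local.
- by move=> *; apply: Delta_lin.
move=> _ [r [e [de ->]]]; rewrite Delta_dilate dilate_comp.
under [X in in_span _ X]eq_fun do under eq_fun do rewrite -mulNr.
apply: in_spanD; last apply: in_spanZ; apply: in_span_gen.
  do 2!eexists; split; last reflexivity.
  by rewrite sum_add_exp sum_unit_exp; lia.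
by exists r, e; split=> //; apply: leq_trans (leqnSn _).
Qed.

Lemma span_dilates_tau d g :
  in_span (dilates d) g -> in_span (dilates d.+1) (tau g).
Proof.
apply: (in_span_op (phi := fun c => c ^+ q)).
- exact: tau_local.
- by move=> *; apply: tau_lin.
move=> _ [r [e [de ->]]].
apply: in_span_germ (germ_eq_sym (dilate_eq r e)) _.
under [X in in_span _ X]eq_fun do under eq_fun do rewrite -mulNr.
apply: in_spanD; last apply: in_spanZ; apply: in_span_gen.
  by exists r.+1, e; split.
by exists r, e; split=> //; apply: leq_trans (leqnSn _).
Qed.

Lemma span_dilates_ds d g :
  in_span (dilates d) g -> in_span (dilates d) (ds g).
Proof.
apply: (in_span_op (phi := @qroot R F C)).
- exact: ds_local.
- by move=> *; apply: ds_lin.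
move=> _ [r [e [de ->]]].
apply: (@in_span_germ _ _ _ _ _ _ (dilate r e f)); last first.
  by apply: in_span_gen; exists r, e.
rewrite ds_dilate dilate_comp.
apply: near0S (dilate_eq r e) => s t.
have -> : add_exp (zero_exp n) e = e by apply/ffunP => j; rewrite !ffunE.
by rewrite add1n => ->; rewrite /Defs.tau exprqK.
Qed.

(** Each factor [Delta_j] or [tau] raises the order of the dilates by one and
   [ds] does not raise it. *)
Lemma carlitz_monomial_dilates r mu e :
  in_span (dilates (r + \sum_i e i)) (carlitz_monomial r mu e f).
Proof.
rewrite /carlitz_monomial; elim: r => [|r IH]; last exact: span_dilates_tau.
elim: mu => [|mu IH]; last exact: span_dilates_ds.
rewrite /= add0n -[X in dilates X](big_enum _ _ xpredT) /=.
elim: (enum 'I_n) => [|j L IH].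
  apply: in_span_gen; exists 0, (zero_exp n).
  by rewrite sum_zero_exp dilate0.
rewrite big_cons /=; elim: (e j) => [|k IHk] //=.
exact: span_dilates_Delta.
Qed.

Definition tau_powers d : fn -> Prop := fun h =>
  exists2 r, (r <= d)%N & h = iter r tau f.

(** Dilating [s] commutes with [tau], and acts on [f] as [tau + x]. *)
Lemma dilate_s_tau_powers r : in_span (tau_powers r) (dilate r (zero_exp n) f).
Proof.
elim: r => [|r IH].
  by apply: in_span_gen; exists 0 => //; rewrite dilate0.
have -> : dilate r.+1 (zero_exp n) f =
    dilate 1 (zero_exp n) (dilate r (zero_exp n) f).
  rewrite dilate_comp add1n; congr (dilate _ _ f).
  by apply/ffunP => j; rewrite !ffunE.
move: IH; apply: (in_span_op (phi := id)) => //; first exact: dilate_local.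
move=> _ [k kr ->]; rewrite dilate_iter_tau.
apply: (@in_span_germ _ _ _ _ _ _
    (iter k tau (fun s t => tau f s t + x * f s t))).
  apply: iter_tau_local; apply: near0S (dilate_eq 0 (zero_exp n)) => s t.
  by rewrite dilate0 => <-; rewrite subrK.
rewrite iter_tau_affine -iterSr.
apply: in_spanD; last apply: in_spanZ; apply: in_span_gen.
  by exists k.+1.
by exists k => //; apply: leq_trans (leqnSn _).
Qed.

Definition tau_Deltas d : fn -> Prop := fun h =>
  exists r e, (r + \sum_i e i <= d)%N /\
    h = iter r tau (Deltas e (enum 'I_n) f).

(** Dilating [t_j] commutes with [tau], and is [Delta_j + x]. *)
Lemma dilate_t_tau_Deltas d j g : in_span (tau_Deltas d) g ->
  in_span (tau_Deltas d.+1) (dilate 0 (unit_exp j) g).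
Proof.
apply: (in_span_op (phi := id)) => //; first exact: dilate_local.
move=> _ [r [e [de ->]]].
rewrite dilate_iter_tau dilate_Delta iter_tau_affine.
apply: in_spanD; last apply: in_spanZ; apply: in_span_gen.
  exists r, (add_exp (unit_exp j) e); split.
    by rewrite sum_add_exp sum_unit_exp addnCA.
  by rewrite -Delta_Deltas ?enum_uniq ?mem_enum.
by exists r, e; split=> //; apply: leq_trans (leqnSn _).
Qed.

(** Monomials without [ds] suffice. The dilations of [t] are peeled off one at
   a time until only a dilation of [s] is left. *)
Lemma dilate_carlitz_monomials r e :
  in_span (carlitz_monomials (r + \sum_i e i)) (dilate r e f).
Proof.
suff : in_span (tau_Deltas (r + \sum_i e i)) (dilate r e f).
  apply: in_span_sub => _ [r' [e' [de ->]]]; apply: in_span_gen.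
  by exists r', 0, e'; rewrite addn0.
move dE : (\sum_i e i)%N => d; elim: d e dE => [|d IH] e dE.
  have -> : e = zero_exp n.
    apply/ffunP => j; rewrite ffunE; apply/eqP; rewrite -leqn0 -dE.
    by rewrite (bigD1 j) //= leq_addr.
  apply: in_span_sub (dilate_s_tau_powers r) => _ [k kr ->]; apply: in_span_gen.
  exists k, (zero_exp n); rewrite sum_zero_exp leq_add2r; split=> //.
  by rewrite Deltas0.
have [j ej] : exists j, (0 < e j)%N.
  apply/existsP; rewrite -[[exists _, _]]negbK negb_exists.
  apply/negP => /forallP h.
  by move: dE; rewrite big1 // => i _; apply/eqP; rewrite -leqn0 leqNgt h.
pose e' : {ffun 'I_n -> nat} := [ffun i => (e i - (i == j))%N].
have eE : e = add_exp (unit_exp j) e'.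
  apply/ffunP => i; rewrite !ffunE; have [->|_] := eqVneq i j => /=; lia.
rewrite addnS eE -[r]add0n -dilate_comp; apply: dilate_t_tau_Deltas.
by apply: IH; apply/eqP; rewrite -eqSS -dE eE sum_add_exp sum_unit_exp.
Qed.

(** The first entry of a tuple is the exponent of the dilation of [s] and the
   others are those of the dilations of [t]; such tuples are counted by a
   binomial coefficient. *)
Definition bounded_exps j : {set n.+1.-tuple 'I_j.+1} :=
  [set u : n.+1.-tuple 'I_j.+1 | \sum_(i <- u) i <= j]%N.

Definition exp_s j (u : n.+1.-tuple 'I_j.+1) : nat := tnth u ord0.

Definition exp_t j (u : n.+1.-tuple 'I_j.+1) : {ffun 'I_n -> nat} :=
  [ffun i => nat_of_ord (tnth u (lift ord0 i))].

Lemma sum_bounded_exp j (u : n.+1.-tuple 'I_j.+1) :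
  (\sum_(i <- u) i = exp_s u + \sum_i exp_t u i)%N.
Proof.
rewrite big_tuple big_ord_recl; congr (_ + _)%N.
by apply: eq_bigr => i _; rewrite ffunE.
Qed.

Lemma exps_inj j :
  injective (fun u : n.+1.-tuple 'I_j.+1 => (exp_s u, exp_t u)).
Proof.
move=> u u' [es et]; apply: eq_from_tnth => i; apply: val_inj.
have [k ->|->] := unliftP ord0 i; last exact: es.
by have := congr1 (fun h : {ffun 'I_n -> nat} => h k) et; rewrite !ffunE.
Qed.

Lemma exps_surj j r e : (r + \sum_i e i <= j)%N ->
  exists2 u, u \in bounded_exps j & exp_s u = r /\ exp_t u = e.
Proof.
move=> de; pose w (i : 'I_n.+1) := if unlift ord0 i is Some k then e k else r.
pose u : n.+1.-tuple 'I_j.+1 := [tuple inord (w i) | i < n.+1].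
have wj i : (w i < j.+1)%N.
  rewrite ltnS; apply: leq_trans de; rewrite /w.
  case: unlift => [k|]; last exact: leq_addr.
  by rewrite (bigD1 k) //= addnCA leq_addr.
have us : exp_s u = r by rewrite /exp_s tnth_mktuple inordK // /w unlift_none.
have ut : exp_t u = e.
  by apply/ffunP => k; rewrite ffunE tnth_mktuple inordK // /w liftK.
by exists u; rewrite // inE sum_bounded_exp us ut.
Qed.

Lemma has_dim_Mfilt j : has_dim (Mfilt f j) #|bounded_exps j|.
Proof.
pose u (i : 'I_#|bounded_exps j|) := enum_val i.
have uP i : u i \in bounded_exps j := enum_valP i.
pose b i := dilate (exp_s (u i)) (exp_t (u i)) f.
exists b; split.
- move=> i; have := dilate_carlitz_monomials (exp_s (u i)) (exp_t (u i)).
  apply: in_span_sub => _ [r [mu [e [de ->]]]]; apply: in_span_gen.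
  exists r, mu, e; split=> //; apply: leq_trans de _.
  by have := uP i; rewrite inE sum_bounded_exp.
- move=> c; apply: (dilates_independent n_gt0) => i i' /exps_inj.
  exact: enum_val_inj.
move=> g Mg; have : in_span (dilates j) g.
  apply: in_span_sub Mg => _ [r [mu [e [de ->]]]].
  apply: span_dilates_le (carlitz_monomial_dilates r mu e).
  by apply: leq_trans de; rewrite leq_add2r leq_addr.
case=> [N [c [b' [b'P gE]]]].
have /choice[h hE] k : exists i, b' k = b i.
  have [r [e [/exps_surj[w wj [<- <-]] ->]]] := b'P k.
  by exists (enum_rank_in wj w); rewrite /b /u enum_rankK_in.
exists (fun i => \sum_(k | h k == i) c k); apply: near0S gE => s t ->.
rewrite /lin_comb (partition_big h xpredT) //=; apply: eq_bigr => i _.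
by rewrite mulr_suml; apply: eq_bigr => k /eqP <-; rewrite hE.
Qed.
End CarlitzModule.

(** * The Hilbert polynomial *)

Definition binomial_poly (m : nat) : {poly rat} :=
  (m`!)%:R^-1 *: \prod_(i < m) ('X + i.+1%:R%:P).

Lemma size_binomial_poly m : size (binomial_poly m) = m.+1.
Proof.
rewrite size_scale ?invr_eq0 ?pnatr_eq0 -?lt0n ?fact_gt0 //.
rewrite (eq_bigr (fun i : 'I_m => 'X - (- i.+1%:R)%:P)).
  by rewrite size_prod_XsubC /index_enum -enumT size_enum_ord.
by move=> i _; rewrite polyCN opprK.
Qed.

Lemma binomial_polyE m j : (binomial_poly m).[j%:R] = ('C(m + j, m))%:R.
Proof.
have m0 : (m`!)%:R != 0 :> rat by rewrite pnatr_eq0 -lt0n fact_gt0.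
rewrite hornerZ; apply: (mulfI m0); rewrite mulVKf // -natrM mulnC bin_ffact.
rewrite horner_prod; elim: m {m0} => [|m IH]; first by rewrite big_ord0 ffactn0.
rewrite big_ord_recr /= IH addSn ffactSS natrM mulrC; congr (_ * _).
by rewrite !hornerE -natrD addnC addSn.
Qed.

Theorem mainTheorem5 (R : realType) (F : finFieldType)
    (C : completedClosure R F) (l la : nat) (hl : (0 < l + la)%N) :
  [/\ near0 (fun (s : C) (t : 'I_(l + la) -> C) =>
        has_sum (thakur_term s t) (thakur_function s t)),
      in_calF (@thakur_function R F C l la)
    & quasi_holonomic (@thakur_function R F C l la)].
Proof.
have inF : in_calF (@thakur_function R F C l la).
  exists (@thakur_coef R F C l la); apply: near0_disc => s t.
  exact: thakur_functionP.
split=> //.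
  apply: near0_disc => s t /(thakur_functionP hl).
  exact: thakur_term_has_sum.
split=> //.
  move=> f0; suff /eqP : (1 : C) = 0 by rewrite oner_eq0.
  apply: (@dilates_independent R F C l la hl _ (fun _ : 'I_1 => 0%N)
    (fun=> zero_exp (l + la)) (fun=> 1) _ _ ord0).
    by move=> i i' _; rewrite !ord1.
  by apply: near0S f0 => s t; rewrite big_ord1 mul1r dilate0.
exists (binomial_poly (l + la).+1); last exact: size_binomial_poly.
exists 0%N => j _; exists #|bounded_exps l la j|; first exact: has_dim_Mfilt.
by rewrite binomial_polyE card_partial_ord_partitions.
Qed.
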